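(* Let $n,m,s,t\in\mathbb{N}$ and let $\lambda_1,\dots,\lambda_{s+t},\mu_1,\dots,\mu_{s+t}$ be indeterminates; write $\boldsymbol{\lambda}=(\lambda_1,\dots,\lambda_s)$, $\boldsymbol{\lambda}'=(\lambda_{s+1},\dots,\lambda_{s+t})$, and similarly $\boldsymbol{\mu},\boldsymbol{\mu}'$. For $\boldsymbol{r}=(r_1,\dots,r_{s+t})\in Z_{s+t,n}$ and $\boldsymbol{k}=(k_1,\dots,k_{s+t})\in Z_{s+t,m}$ put $S(\boldsymbol{r},\boldsymbol{k}):=\prod_{l=1}^{s+t}S^{\mathrm{sgn}}_{r_l,k_l}$ and $q(\boldsymbol{r},\boldsymbol{k}):=\sum_{l=s+1}^{s+t}(r_l+k_l)+t$. Then in $\mathscr{A}[\lambda_1,\dots,\lambda_{s+t},\mu_1,\dots,\mu_{s+t}]$, \[ \sum_{\substack{\boldsymbol{r}\in Z_{s+t,n}\\ \boldsymbol{k}\in Z_{s+t,m}}}(-1)^{q(\boldsymbol{r},\boldsymbol{k})}\Big(\prod_{l=1}^{s+t}\lambda_l^{r_l}\mu_l^{k_l}\Big) \sum_{(\boldsymbol{\alpha}_1,\ldots,\boldsymbol{\alpha}_{s+t})\in S(\boldsymbol{r},\boldsymbol{k})}\Big(\prod_{u=1}^t \mathrm{sgn}(\boldsymbol{\alpha}_{s+u})\Big)\zeta_{\mathscr{A}}(\boldsymbol{\alpha}_1,\ldots,\boldsymbol{\alpha}_s,\boldsymbol{\alpha}_{s+t},\ldots,\boldsymbol{\alpha}_{s+1})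 \] \[ =\sum_{\sigma\in W_{s,t}}\ \sum_{\substack{\boldsymbol{r}\in Z_{s+t,n}\\ \boldsymbol{k}\in Z_{s+t,m}}}\Big(\prod_{l=1}^{s+t} P_l^{\sigma}(\boldsymbol{\lambda},\boldsymbol{\lambda}')^{r_l}\,P_l^{\sigma}(\boldsymbol{\mu},\boldsymbol{\mu}')^{k_l}\Big) \sum_{(\boldsymbol{\alpha}_1,\ldots,\boldsymbol{\alpha}_{s+t})\in S(\boldsymbol{r},\boldsymbol{k})}\zeta_{\mathscr{A}}(\boldsymbol{\alpha}_1,\ldots,\boldsymbol{\alpha}_{s+t}), \] where $(\boldsymbol{\alpha}_1,\dots)$ denotes concatenation of the indices (blocks) in the order written, each block keeping its internal order.
   Context: $\mathscr{A}:=\left(\prod_{p \text{ prime}}\mathbb{Z}/p\mathbb{Z}\right)\big/\left(\bigoplus_{p\text{ prime}}\mathbb{Z}/p\mathbb{Z}\right)$. $\mathbb{N}=\{1,2,\dots\}$, $\mathbb{D}:=\mathbb{Z}\setminus\{0\}$; for $a\in\mathbb{D}$, $\mathrm{sgn}(a)\in\{\pm1\}$ is its sign and $|a|$ its absolute value. For an index $\boldsymbol{\alpha}=(\alpha_1,\dots,\alpha_r)\in\mathbb{D}^r$: $|\boldsymbol{\alpha}|=\sum|\alpha_i|$, $\mathrm{sgn}(\boldsymbol{\alpha})=\prod\mathrm{sgn}(\alpha_i)$, and $\zeta_{\mathscr{A}}(\boldsymbol{\alpha}):=\left(\sum_{0<m_1<\cdots<m_r<p}\frac{\mathrm{sgn}(\alpha_1)^{m_1}\cdots\mathrm{sgn}(\alpha_r)^{m_r}}{m_1^{|\alpha_1|}\cdots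 m_r^{|\alpha_r|}} \bmod p\right)_p\in\mathscr{A}$. For non-negative integers $i,j$, $S_{i,j}^{\mathrm{sgn}}:=\{\boldsymbol{\alpha}\in\mathbb{D}^{i+1}\mid |\boldsymbol{\alpha}|=i+j+1\}$. For positive integers $N$ and non-negative $M$, $Z_{N,M}:=\{(x_1,\dots,x_N)\in\mathbb{Z}_{\ge0}^N\mid x_1+\cdots+x_N=M\}$. $W_{s,t}:=\{\sigma\in\mathfrak{S}_{s+t}\mid \sigma(1)<\cdots<\sigma(s),\ \sigma(s+1)<\cdots<\sigma(s+t)\}$. For $\sigma\in W_{s,t}$, the linear forms $P_i^\sigma(\boldsymbol{\lambda},\boldsymbol{\lambda}')$ ($1\le i\le s+t$) with integer coefficients are the unique coefficients such that, for $L_1(a,b):=\log\frac{1-a}{1-b}$ and all $0<t_{\sigma^{-1}(1)}<\cdots<t_{\sigma^{-1}(s+t)}<z<1$ (with $t_{\sigma^{-1}(s+t+1)}:=z$), $\sum_{i=1}^{s-1}\lambda_iL_1(t_i,t_{i+1})+\lambda_sL_1(t_s,z)+\sum_{j=s+1}^{s+t-1}\lambda_jL_1(t_j,t_{j+1})+\lambda_{s+t}L_1(t_{s+t},z)=\sum_{i=1}^{s+t}P_i^\sigma(\boldsymbol{\lambda},\boldsymbol{\lambda}')L_1(t_{\sigma^{-1}(i)},t_{\sigma^{-1}(i+1)})$. Explicitly, setting $e(j):=\sigma(j+1)$ for $j\notin\{s,s+t\}$ and $e(s)=e(s+t):=s+t+1$, one has $P_i^\sigma(\boldsymbol{\lambda},\boldsymbol{\lambda}')=\sum_{j:\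 \sigma(j)\le i<e(j)}\lambda_j$. $P_i^\sigma(\boldsymbol{\mu},\boldsymbol{\mu}')$ is the same linear form in $\mu_1,\dots,\mu_{s+t}$. *)

(* Defs.v *)
From HB Require Import structures.
From mathcomp Require Import all_boot all_order all_fingroup all_algebra.
From mathcomp Require Import finmap mpoly.
From mathcomp Require Import boolp classical_sets functions cardinality.

Set Implicit Arguments.
Unset Strict Implicit.
Unset Printing Implicit Defensive.

Import GRing.Theory.
Local Open Scope ring_scope.
Local Open Scope quotient_scope.

Definition primeT := {p : nat | prime p}.

Definition prodFp : Type := forall p : primeT, 'F_(val p).

HB.instance Definition _ := gen_eqMixin prodFp.
HB.instance Definition _ := gen_choiceMixin prodFp.

Section ProdRing.
Implicit Types x y z : prodFp.

Definition pf_zero : prodFp := fun=> 0.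
Definition pf_one : prodFp := fun=> 1.
Definition pf_opp x : prodFp := fun p => - x p.
Definition pf_add x y : prodFp := fun p => x p + y p.
Definition pf_mul x y : prodFp := fun p => x p * y p.

Fact pf_addA : associative pf_add.
Proof. by move=> x y z; apply: functional_extensionality_dep => p; apply: addrA. Qed.
Fact pf_addC : commutative pf_add.
Proof. by move=> x y; apply: functional_extensionality_dep => p; apply: addrC. Qed.
Fact pf_add0 : left_id pf_zero pf_add.
Proof. by move=> x; apply: functional_extensionality_dep => p; apply: add0r. Qed.
Fact pf_addN : left_inverse pf_zero pf_opp pf_add.
Proof. by move=> x; apply: functional_extensionality_dep => p; apply: addNr. Qed.
Fact pf_mulA : associative pf_mul.
Proof. by move=> x y z; apply: functional_extensionality_dep => p; apply: mulrA. Qed.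
Fact pf_mulC : commutative pf_mul.
Proof. by move=> x y; apply: functional_extensionality_dep => p; apply: mulrC. Qed.
Fact pf_mul1 : left_id pf_one pf_mul.
Proof. by move=> x; apply: functional_extensionality_dep => p; apply: mul1r. Qed.
Fact pf_mulD : left_distributive pf_mul pf_add.
Proof. by move=> x y z; apply: functional_extensionality_dep => p; apply: mulrDl. Qed.

Fact pf_one_neq0 : pf_one != pf_zero.
Proof.
apply/eqP => /(congr1 (fun x : prodFp => x (exist prime 2%N isT))).
by move/eqP; rewrite /pf_one /pf_zero oner_eq0.
Qed.

HB.instance Definition _ :=
  GRing.isZmodule.Build prodFp pf_addA pf_addC pf_add0 pf_addN.
HB.instance Definition _ := GRing.Zmodule_isComNzRing.Build prodFp
  pf_mulA pf_mulC pf_mul1 pf_mulD pf_one_neq0.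

End ProdRing.

(* The ideal \bigoplus_p Z/pZ: the families with finite support. *)
Definition sumFp : {pred prodFp} :=
  fun x => `[< finite_set [set p : primeT | x p != 0]%classic >].

Fact sumFp_idealr_closed : idealr_closed sumFp.
Proof.
split.
- apply/asboolP; apply: (@sub_finite_set _ _ classical_sets.set0) => [p /=|]; first by [].
  exact: finite_set0.
- apply/asboolP => fin1.
  have {fin1} : finite_set [set: primeT]%classic.
    by apply: sub_finite_set fin1 => p _; exact: (oner_neq0 'F_(val p)).
  case/finite_seqP => ps Eps.
  have [q q_gt q_pr] := prime_above (\max_(p <- ps) val p).
  have : exist prime q q_pr \in ps.
    by have : [set` ps]%classic (exist prime q q_pr) by rewrite -Eps.
  move=> qps; have := @leq_bigmax_seq _ _ xpredT (fun p : primeT => val p) _ qps isT.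
  by rewrite /= leqNgt q_gt.
move=> a x y /asboolP xfin /asboolP yfin; apply/asboolP.
have := conj xfin yfin; rewrite -finite_setU; apply: sub_finite_set => p /=.
have -> : (a * x + y) p = a p * x p + y p by [].
have [->|xp0] := eqVneq (x p) 0; last by left.
by rewrite mulr0 add0r; right.
Qed.

HB.instance Definition _ := isIdealr.Build prodFp sumFp sumFp_idealr_closed.

Definition calA := {ideal_quot sumFp}.

Definition nzint := {a : int | a != 0}.

Definition sgn (a : seq nzint) : int := \prod_(x <- a) sgz (val x).
Definition weight (a : seq nzint) : nat := (\sum_(x <- a) `|val x|)%N.

Definition zeta_p (a : seq nzint) (p : primeT) : 'F_(val p) :=
  \sum_(m : (size a).-tuple 'I_(val p) | path ltn 0%N [seq val x | x <- m])
    \prod_(i < size a)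
      let ai := val (tnth (in_tuple a) i) in
      let mi := val (tnth m i) in
      (sgz ai)%:~R ^+ mi / mi%:R ^+ `|ai|%N.

Definition zetaA (a : seq nzint) : calA := \pi_calA (zeta_p a : prodFp).

Definition Ssgn (i j : nat) : set (seq nzint) :=
  [set a | size a = i.+1 /\ weight a = (i + j + 1)%N]%classic.

Definition Zset (N M : nat) : set {ffun 'I_N -> nat} :=
  [set x : {ffun 'I_N -> nat} | (\sum_(l < N) x l)%N = M]%classic.
Arguments Zset : clear implicits.

Definition Sprod N (r k : {ffun 'I_N -> nat}) : set {ffun 'I_N -> seq nzint} :=
  [set a : {ffun 'I_N -> seq nzint} | forall l, Ssgn (r l) (k l) (a l)]%classic.

(* The statement sums over [fset_set X], which enumerates X when X is finite and
   is empty otherwise; the next three facts rule out the latter. *)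
Lemma finite_Zset N M : finite_set (Zset N M).
Proof.
pose f (y : {ffun 'I_N -> 'I_M.+1}) : {ffun 'I_N -> nat} := [ffun l => val (y l)].
apply: (@sub_finite_set _ _ (f @` setT)%classic).
  move=> x /= xM; exists [ffun l => inord (x l)] => //.
  apply/ffunP => l; rewrite !ffunE /= inordK // ltnS -xM.
  by rewrite (bigD1 l) //= leq_addr.
exact/finite_image/finite_finset.
Qed.

Lemma finite_Ssgn i j : finite_set (Ssgn i j).
Proof.
pose w := (i + j + 1)%N.
pose g (b : bool * 'I_w.+1) : seq nzint :=
  seq_of_opt (insub (if b.1 then - (b.2 : nat)%:Z else (b.2 : nat)%:Z)).
pose f (y : {ffun 'I_i.+1 -> bool * 'I_w.+1}) : seq nzint :=
  flatten [seq g (y l) | l <- enum 'I_i.+1].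
apply: (@sub_finite_set _ _ (f @` setT)%classic); last first.
  exact/finite_image/finite_finset.
move=> a /= [sza wa].
pose x0 : nzint := exist _ 1 isT.
exists [ffun l : 'I_i.+1 => (val (nth x0 a l) < 0, inord `|val (nth x0 a l)|%N)] => //.
rewrite /f (_ : [seq _ | l <- _] = [seq [:: nth x0 a (val l)] | l <- enum 'I_i.+1]).
  rewrite (map_comp (fun n => [:: nth x0 a n]) val) val_enum_ord.
  rewrite (map_comp (fun x => [:: x])) -sza map_nth_iota0 // take_size.
  by elim: (a) => //= x s ->.
apply: eq_map => l; rewrite ffunE /g /=.
have la : (l < size a)%N by rewrite sza.
have wl : (`|val (nth x0 a l)| < w.+1)%N.
  rewrite ltnS /w -wa /weight (big_nth x0) big_mkord.
  by rewrite (bigD1 (Ordinal la)) //= leq_addr.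
rewrite inordK //.
have -> : (if val (nth x0 a l) < 0 then - (`|val (nth x0 a l)|%N)%:Z
           else (`|val (nth x0 a l)|%N)%:Z) = val (nth x0 a l).
  by case: (val _) => k.
by rewrite valK.
Qed.

Lemma finite_Sprod N (r k : {ffun 'I_N -> nat}) : finite_set (Sprod r k).
Proof.
have E l : exists e : seq (seq nzint), Ssgn (r l) (k l) = [set` e]%classic.
  exact/finite_seqP/finite_Ssgn.
pose e l : seq (seq nzint) := sval (cid (E l)).
have He l : Ssgn (r l) (k l) = [set` e l]%classic by rewrite /e; case: cid.
pose M := (\max_l size (e l))%N.
pose f (y : {ffun 'I_N -> 'I_M.+1}) : {ffun 'I_N -> seq nzint} :=
  [ffun l => nth [::] (e l) (y l)].
apply: (@sub_finite_set _ _ (f @` setT)%classic); last first.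
  exact/finite_image/finite_finset.
move=> a /= Ha; exists [ffun l => inord (index (a l) (e l))] => //.
apply/ffunP => l; rewrite !ffunE; have := Ha l; rewrite He /= => al.
rewrite inordK ?nth_index // ltnS (leq_trans (index_size _ _)) //.
exact: (leq_bigmax (F := fun l => size (e l))).
Qed.

(* Positions are numbered from 0: j : 'I_(s + t) stands for j + 1 in 1..s+t. *)

Definition Wset (s t : nat) : {set 'S_(s + t)} :=
  [set sigma : 'S_(s + t) |
    [forall i : 'I_s, forall j : 'I_s,
       (i < j)%N ==> (sigma (lshift t i) < sigma (lshift t j))%N] &&
    [forall i : 'I_t, forall j : 'I_t,
       (i < j)%N ==> (sigma (rshift s i) < sigma (rshift s j))%N]].

(* The end of the segment of j is s + t exactly when j + 1 is s or s + t (the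
   last position of its block); [insub] fails in the latter case. *)
Definition e_end s t (sigma : 'S_(s + t)) (j : 'I_(s + t)) : nat :=
  match insub j.+1 : option 'I_(s + t) with
  | Some j' => if j.+1 == s then (s + t)%N else sigma j'
  | None => (s + t)%N
  end.

Definition Pform s t (sigma : 'S_(s + t)) (V : nmodType)
    (x : 'I_(s + t) -> V) (i : 'I_(s + t)) : V :=
  \sum_(j < s + t | (sigma j <= i < e_end sigma j)%N) x j.

(* The defining identity of the P_i^sigma, where L_1(a,b) = g a - g b with
   g = log(1 - _), h j = g(t_j), hz = g(z). *)
Section PformSpec.
Variables (R : pzRingType) (s t : nat) (sigma : 'S_(s + t)).
Variables (h : 'I_(s + t) -> R) (hz : R).

Definition next_val (j : 'I_(s + t)) : R :=
  if j.+1 == s then hz else oapp h hz (insub j.+1).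

Definition sorted_val (i : nat) : R :=
  oapp (fun i' => h (sigma^-1%g i')) hz (insub i).

Lemma Pform_spec (x : 'I_(s + t) -> R) : sigma \in Wset s t ->
  \sum_(j < s + t) x j * (h j - next_val j) =
  \sum_(i < s + t) Pform sigma x i * (sorted_val i - sorted_val i.+1).
Proof.
move=> sW.
under [RHS]eq_bigr => i _ do rewrite /Pform big_mkcond mulr_suml.
rewrite exchange_big; apply: eq_bigr => j _ /=.
have sj : sorted_val (sigma j) = h j by rewrite /sorted_val valK /= permK.
have ej : sorted_val (e_end sigma j) = next_val j.
  rewrite /next_val /e_end; case: insubP => [j' _ ej'|_] /=.
    case: ifP => _; first by rewrite /sorted_val insubF // ltnn.
    by rewrite /sorted_val valK /= permK.
  by rewrite if_same /sorted_val insubF // ltnn.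
have le_e : (sigma j <= e_end sigma j)%N.
  rewrite /e_end; case: insubP => [j' _ ej'|_]; last exact: ltnW.
  case: ifP => [_|/negbT js]; first exact: ltnW.
  move: sW; rewrite inE => /andP[/forallP Wl /forallP Wr]; apply: ltnW.
  case: (split_ordP j) (split_ordP j') => [i ei|i ei] [i' ei'|i' ei'];
    move: js ej'; rewrite ei ei' /= => js ej'.
  - by have /forallP/(_ i')/implyP := Wl i; apply; rewrite ej'.
  - by move: js; rewrite eqn_leq (ltn_ord i) -ej' leq_addr.
  - by have := ltn_ord i'; rewrite ej' -addnS ltnNge leq_addr.
  - have /forallP/(_ i')/implyP := Wr i; apply.
    by rewrite -(ltn_add2l s) ej'.
have lt_e : (e_end sigma j <= s + t)%N.
  by rewrite /e_end; case: insubP => // j' _ _; case: ifP => // _; apply: ltnW.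
have -> : h j - next_val j =
          \sum_(sigma j <= i < e_end sigma j) (sorted_val i - sorted_val i.+1).
  rewrite -sj -ej -opprB -(telescope_sumr _ le_e) -sumrN.
  by apply: eq_bigr => i _; rewrite opprB.
rewrite (big_nat_widen _ _ _ _ _ lt_e) big_geq_mkord mulr_sumr big_mkcond /=.
apply: eq_bigr => i _; rewrite andbC.
by case: ifP => _; rewrite ?mul0r.
Qed.
End PformSpec.

Definition lam s t (l : 'I_(s + t)) : {mpoly calA[(s + t) + (s + t)]} :=
  'X_(lshift (s + t) l).
Definition mu s t (l : 'I_(s + t)) : {mpoly calA[(s + t) + (s + t)]} :=
  'X_(rshift (s + t) l).

Definition q_exp s t (r k : {ffun 'I_(s + t) -> nat}) : nat :=
  (\sum_(u < t) (r (rshift s u) + k (rshift s u)) + t)%N.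

Definition concat s t (a : {ffun 'I_(s + t) -> seq nzint}) : seq nzint :=
  flatten [seq a l | l <- enum 'I_(s + t)].

Definition concat_rev s t (a : {ffun 'I_(s + t) -> seq nzint}) : seq nzint :=
  flatten [seq a (lshift t l) | l <- enum 'I_s] ++
  flatten (rev [seq a (rshift s u) | u <- enum 'I_t]).

(* Main.v *)
From HB Require Import structures.
Require Import Defs.
From mathcomp Require Import all_boot all_order all_fingroup all_algebra.
From mathcomp Require Import finmap mpoly.
From mathcomp Require Import boolp classical_sets functions cardinality.
From mathcomp Require Import zify ring.

(** Fix an odd prime p.  In the blocks that carry the sign [sgn] on the left-hand
    side, the substitution m -> p - m leaves every summand unchanged up to the
    factor absorbed by [q_exp], and turns the condition that the last index of
    the first s blocks is smaller than the indices of the t remaining ones into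
    a_max + b_max < p.  The left-hand side is therefore a truncated product of
    two power series, and the theorem is their shuffle product.

    Summing over the signs keeps even summation indices only, and the generating
    series F_l of l blocks with parameters (x_i, y_i) satisfies
      z F_l' = y_l F_l + 2 z^2 / (1 - z^2) (x_l F_l + F_(l-1)).
    A product F_i G_j satisfies the same kind of equation, with parameters
    x_i + x'_j and y_i + y'_j and with F_(i-1) G_j + F_i G_(j-1) as the lower
    term, and so does the sum over the shuffles of the two lists of blocks: the
    sums of parameters met along a shuffle sigma are the P_i^sigma.  The
    coefficients of z^N with 0 < N < p are determined by the equation. *)

Set Implicit Arguments.
Unset Strict Implicit.
Unset Printing Implicit Defensive.
Import GRing.Theory.
Local Open Scope ring_scope.

(** * Convolutions *)

Section Convolution.
Variable R : comNzRingType.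
Implicit Types (h : nat -> R) (F G : nat -> nat -> nat -> R).

Definition cumul h N : R := \sum_(M < N) h M.

(** On a series with only even powers of z this is multiplication by [2 z^2 / (1 - z^2)]; in general
    it is the even part of the product with [2 z / (1 - z)]. *)
Definition ecumul h N : R := if odd N then 0 else 2 * cumul h N.

(** Multiplication by a formal variable that records the degree [n]; [down2] does the same for
    [m]. *)
Definition down1 F n m N : R := if n is n'.+1 then F n' m N else 0.
Definition down2 F n m N : R := if m is m'.+1 then F n m' N else 0.

Definition conv3 F G n m N : R :=
  \sum_(i < n.+1) \sum_(j < m.+1) \sum_(M < N.+1)
    F i j M * G (n - i)%N (m - j)%N (N - M)%N.

Definition evensupp F := forall n m N, odd N -> F n m N = 0.

Lemma conv3C F G n m N : conv3 F G n m N = conv3 G F n m N.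
Proof.
rewrite /conv3 (reindex_inj rev_ord_inj); apply: eq_bigr => i _.
rewrite (reindex_inj rev_ord_inj); apply: eq_bigr => j _.
rewrite (reindex_inj rev_ord_inj); apply: eq_bigr => M _ /=.
by rewrite !subSS !subKn 1?mulrC // -ltnS.
Qed.

Lemma conv3_down1 F G n m N :
  conv3 (down1 F) G n m N = down1 (conv3 F G) n m N.
Proof.
rewrite /conv3; case: n => [|n].
  by rewrite big1 // => -[[] //= _] _; rewrite !big1 // => j _; rewrite big1 // => M _; rewrite mul0r.
rewrite big_ord_recl big1 ?add0r => [|j _]; last by rewrite big1 // => M _; rewrite mul0r.
by apply: eq_bigr => i _.
Qed.

Lemma conv3_down2 F G n m N :
  conv3 (down2 F) G n m N = down2 (conv3 F G) n m N.
Proof.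
rewrite /conv3; case: m => [|m].
  by rewrite big1 // => i _; rewrite big_ord1 big1 // => M _; rewrite mul0r.
apply: eq_bigr => i _.
rewrite big_ord_recl big1 ?add0r => [|M _]; last by rewrite mul0r.
by apply: eq_bigr => j _.
Qed.

(** Both sides are the coefficient of z^N in [z / (1 - z)] times the product of the two series. *)
Lemma conv_cumul (f g : nat -> R) N :
  \sum_(M < N.+1) cumul f M * g (N - M)%N =
  \sum_(K < N) \sum_(M < K.+1) f M * g (K - M)%N.
Proof.
elim: N => [|N IHN]; first by rewrite big_ord1 big_ord0 /cumul big_ord0 mul0r.
rewrite [RHS]big_ord_recr /= -IHN big_ord_recl /= /cumul big_ord0 mul0r add0r.
rewrite -big_split; apply: eq_bigr => M _.
by rewrite subSS big_ord_recr /= mulrDl.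
Qed.

(** When M and N have different parity, N - M is odd and [g] vanishes there, so the parity test can
    be made on N instead of M. *)
Lemma conv_ecumul (f g : nat -> R) N : (forall M, odd M -> g M = 0) ->
  \sum_(M < N.+1) ecumul f M * g (N - M)%N =
  ecumul (fun K => \sum_(M < K.+1) f M * g (K - M)%N) N.
Proof.
move=> gev; rewrite /ecumul /cumul.
have [Nodd|Nev] := boolP (odd N).
  rewrite big1 // => -[M /= leMN] _.
  case: ifP => [|Mev]; first by rewrite mul0r.
  by rewrite gev ?mulr0 // oddB // Nodd Mev.
rewrite -conv_cumul mulr_sumr; apply: eq_bigr => -[M /= leMN] _.
case: ifP => Mev; last by rewrite mulrA.
by rewrite gev ?mulr0 ?mul0r // oddB // (negbTE Nev) Mev.
Qed.

Lemma ecumul_sum (I : Type) (r : seq I) (P : pred I) (h : I -> nat -> R) N :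
  ecumul (fun M => \sum_(i <- r | P i) h i M) N =
  \sum_(i <- r | P i) ecumul (h i) N.
Proof.
rewrite /ecumul /cumul; case: ifP => _; first by rewrite big1.
by rewrite exchange_big mulr_sumr.
Qed.

Lemma ecumulD h1 h2 N :
  ecumul (fun M => h1 M + h2 M) N = ecumul h1 N + ecumul h2 N.
Proof.
rewrite /ecumul /cumul; case: ifP => _; first by rewrite addr0.
by rewrite big_split mulrDr.
Qed.

Lemma ecumulZ c h N : ecumul (fun M => c * h M) N = c * ecumul h N.
Proof.
by rewrite /ecumul /cumul; case: ifP => _; rewrite ?mulr0 // -mulr_sumr mulrCA.
Qed.

Lemma eq_ecumul h1 h2 N : (forall M, (M < N)%N -> h1 M = h2 M) ->
  ecumul h1 N = ecumul h2 N.
Proof.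
move=> e; rewrite /ecumul /cumul; case: ifP => // _; congr (_ * _).
by apply: eq_bigr => M _; apply: e.
Qed.

Lemma conv3_ecumul F G n m N : evensupp G ->
  conv3 (fun i j => ecumul (F i j)) G n m N = ecumul (conv3 F G n m) N.
Proof.
move=> Gev; rewrite /conv3 ecumul_sum; apply: eq_bigr => i _.
rewrite ecumul_sum; apply: eq_bigr => j _.
by rewrite conv_ecumul // => M; apply: Gev.
Qed.

Lemma conv3Dl F1 F2 G n m N :
  conv3 (fun i j M => F1 i j M + F2 i j M) G n m N =
  conv3 F1 G n m N + conv3 F2 G n m N.
Proof.
rewrite /conv3 -big_split; apply: eq_bigr => i _; rewrite -big_split.
by apply: eq_bigr => j _; rewrite -big_split; apply: eq_bigr => M _; rewrite mulrDl.
Qed.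

Lemma conv3Zl c F G n m N :
  conv3 (fun i j M => c * F i j M) G n m N = c * conv3 F G n m N.
Proof.
rewrite /conv3 mulr_sumr; apply: eq_bigr => i _; rewrite mulr_sumr.
by apply: eq_bigr => j _; rewrite mulr_sumr; apply: eq_bigr => M _; rewrite mulrA.
Qed.

(** Leibniz rule for z d/dz. The second product is written with its factors exchanged, so that the
    differentiated factor is always the first one. *)
Lemma conv3_deriv F G n m N :
  N%:R * conv3 F G n m N =
  conv3 (fun i j M => M%:R * F i j M) G n m N +
  conv3 (fun i j M => M%:R * G i j M) F n m N.
Proof.
rewrite [X in _ = _ + X]conv3C /conv3 mulr_sumr -big_split; apply: eq_bigr => i _.
rewrite mulr_sumr -big_split; apply: eq_bigr => j _.
rewrite mulr_sumr -big_split; apply: eq_bigr => -[M /= leMN] _.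
by rewrite -{1}(subnKC (leMN : (M <= N)%N)) natrD; ring.
Qed.

Lemma eq_conv3l F1 F2 G n m N :
  (forall i j M, (M <= N)%N -> F1 i j M = F2 i j M) ->
  conv3 F1 G n m N = conv3 F2 G n m N.
Proof.
move=> e; apply: eq_bigr => i _; apply: eq_bigr => j _.
by apply: eq_bigr => -[M ?] _; rewrite e.
Qed.

End Convolution.

(** * Indices and nested sums *)

(** One step away from 0 that keeps the sign of a nonzero integer; 0 goes to 1, so the result is
    never 0. *)
Definition incz (z : int) : int :=
  match z with Posz k => Posz k.+1 | Negz k => Negz k.+1 end.

Fact incz_neq0 z : incz z != 0. Proof. by case: z. Qed.

Definition inc_nz (a : nzint) : nzint := exist _ (incz (val a)) (incz_neq0 _).
Definition nz1 : nzint := exist _ 1 isT.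
Definition nzN1 : nzint := exist _ (-1) isT.

Lemma inc_nz_inj : injective inc_nz.
Proof.
move=> a b /(congr1 val) /= e; apply: val_inj; move: e => /=.
by case: (val a) (val b) => i [] j //= [->].
Qed.

Lemma absz_inc_nz a : `|val (inc_nz a)|%N = `|val a|.+1.
Proof. by case: a => -[]. Qed.

Lemma sgz_inc_nz a : sgz (val (inc_nz a)) = sgz (val a).
Proof. by case: a => -[[]|]. Qed.

Lemma absz_nz_gt0 (a : nzint) : (0 < `|val a|)%N.
Proof. by rewrite absz_gt0 (valP a). Qed.

(** The case analysis behind [indices]: a head has absolute value 1, with either sign, or arises
    from another nonzero integer by a step away from 0. *)
Variant nz_spec : nzint -> Prop :=
| NzOne : nz_spec nz1
| NzNegOne : nz_spec nzN1
| NzInc a : nz_spec (inc_nz a).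

Lemma nzP a : nz_spec a.
Proof.
case: a => -[[|[|k]]|[|k]] // a0.
- by rewrite (_ : exist _ _ _ = nz1) ; [constructor | apply: val_inj].
- rewrite (_ : exist _ _ _ = inc_nz (exist _ (Posz k.+1) isT)); first by constructor.
  exact: val_inj.
- by rewrite (_ : exist _ _ _ = nzN1) ; [constructor | apply: val_inj].
- rewrite (_ : exist _ _ _ = inc_nz (exist _ (Negz k) isT)); first by constructor.
  exact: val_inj.
Qed.

Definition inc_head (a : seq nzint) : seq nzint :=
  if a is x :: b then inc_nz x :: b else [::].

(* Weight [w], length [n]; the recursion matches multiplication of the nested
   sums by the largest summation index. *)
Fixpoint indices (w n : nat) : seq (seq nzint) :=
  match w, n with
  | 0, 0 => [:: [::]]
  | w'.+1, n'.+1 => map inc_head (indices w' n'.+1) ++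
      (map (cons nz1) (indices w' n') ++ map (cons nzN1) (indices w' n'))
  | _, _ => [::]
  end.

Lemma weight_nil : weight [::] = 0%N. Proof. by rewrite /weight big_nil. Qed.

Lemma weight_cons x b : weight (x :: b) = (`|val x| + weight b)%N.
Proof. by rewrite /weight big_cons. Qed.

Lemma inc_nz_neq (a y : nzint) : `|val a|%N = 1%N -> (inc_nz y == a) = false.
Proof.
move=> a1; apply/negP => /eqP e; have := absz_nz_gt0 y.
by move: (absz_inc_nz y); rewrite e a1 => -[<-].
Qed.

Lemma mem_map_cons (x y : nzint) b l :
  (x :: b \in map (cons y) l) = (x == y) && (b \in l).
Proof.
apply/mapP/andP => [[c cl [-> ->]]|[/eqP-> bl]]; first by rewrite eqxx.
by exists b.
Qed.

Lemma mem_map_inc_head x b l :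
  (inc_nz x :: b \in map inc_head l) = (x :: b \in l).
Proof.
apply/mapP/idP => [[[|y c] // cl [e ->]]|xl].
  by have /inc_nz_inj -> : inc_nz x = inc_nz y by apply: val_inj.
by exists (x :: b).
Qed.

Lemma notin_map_inc_head (x : nzint) b l :
  `|val x|%N = 1%N -> (x :: b \in map inc_head l) = false.
Proof.
move=> x1; apply/mapP => -[[|y c] // _ [] /eqP].
by rewrite eq_sym inc_nz_neq.
Qed.

Lemma mem_indices w n a :
  (a \in indices w n) = (size a == n) && (weight a == w).
Proof.
elim: w n a => [|w IHw] [|n] a.
- by rewrite inE; case: a => [|x b] //=; rewrite weight_nil.
- case: a => [|x b] //=; rewrite weight_cons in_nil.
  by have := absz_nz_gt0 x; lia.
- by case: a => [|x b] //=; rewrite weight_nil.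
rewrite /= !mem_cat; case: a => [|x b].
  rewrite /= !(introF mapP) //; first by case.
  - by case.
  - by case=> -[|y c]; rewrite ?IHw.
rewrite !mem_map_cons.
case: (nzP x) => [||y].
- by rewrite notin_map_inc_head // !IHw weight_cons /= orbF; lia.
- by rewrite notin_map_inc_head // !IHw weight_cons /=; lia.
rewrite mem_map_inc_head !inc_nz_neq // !IHw !weight_cons absz_inc_nz /=.
by rewrite orbF; lia.
Qed.

Lemma uniq_indices w n : uniq (indices w n).
Proof.
elim: w n => [|w IHw] [|n] //=.
have cinj y : injective (cons y : seq nzint -> _) by move=> a b [].
rewrite !cat_uniq !(map_inj_uniq (cinj _)) !IHw map_inj_in_uniq ?IHw; last first.
  move=> [|x b] [|y c] //=; rewrite ?mem_indices // => _ _ [e ->].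
  by have /inc_nz_inj -> : inc_nz x = inc_nz y by apply: val_inj.
rewrite andbT /=; apply/andP; split; apply/hasPn => a; last first.
  by case/mapP=> b _ ->; apply: negbT; apply: etrans (mem_map_cons _ _ _ _) _.
by rewrite mem_cat => /orP[] /mapP[b _ ->]; apply: negbT; apply: notin_map_inc_head.
Qed.

(** Each entry contributes at least 1 to the weight. *)
Lemma indices_small w n : (w < n)%N -> indices w n = [::].
Proof.
move=> lt_wn; case E: (indices w n) => [//|a l].
have : a \in indices w n by rewrite E mem_head.
rewrite mem_indices => /andP[/eqP sa /eqP wa].
suff : (size a <= weight a)%N by rewrite sa wa leqNgt lt_wn.
elim: (a) => [|x b IHb] //=; rewrite weight_cons.
by have := absz_nz_gt0 x; lia.
Qed.

Lemma indices0 w : indices w 0 = if w is 0 then [:: [::]] else [::].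
Proof. by case: w. Qed.

Lemma big_indices (R : nmodType) i j (F : seq nzint -> R) :
  \sum_(a <- fset_set (Ssgn i j)) F a = \sum_(a <- indices (i + j).+1 i.+1) F a.
Proof.
apply: perm_big; apply: uniq_perm; rewrite ?fset_uniq ?uniq_indices // => a.
rewrite in_fset_set; last exact: finite_Ssgn.
rewrite mem_indices; apply/idP/andP; rewrite inE /Ssgn /= addn1.
  by case=> -> ->.
by case=> /eqP-> /eqP->.
Qed.

(** Reversal preserves length and weight, so a block may be summed in either internal order. *)
Lemma perm_indices_rev w n : perm_eq (map rev (indices w n)) (indices w n).
Proof.
have rinj : injective (@rev nzint) by apply: can_inj; apply: revK.
apply: uniq_perm; rewrite ?(map_inj_uniq rinj) ?uniq_indices // => a.
rewrite -{1}[a]revK (mem_map rinj) !mem_indices size_rev.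
by rewrite /weight (perm_big a) //= perm_rev.
Qed.

(** * Nested sums, their recursion and the generating series of blocks *)

Section Run.
Variable R : comNzRingType.
Implicit Types (f : nat -> R) (h : nat -> R).

(* Nested sums: the head of the list is attached to the largest summation index. *)
Fixpoint run (fs : seq (nat -> R)) h : nat -> R :=
  if fs is f :: fs' then fun N => f N * cumul (run fs' h) N else h.

(** The constant series 1. As a seed of [run] it places a fictitious index 0 below all others, which
    forces the true indices to be positive. *)
Definition delta0 (N : nat) : R := (N == 0%N)%:R.

Lemma run_cat fs gs h : run (fs ++ gs) h = run fs (run gs h).
Proof. by elim: fs => //= f fs ->. Qed.

Lemma eq_cumul h1 h2 N : (forall M, (M < N)%N -> h1 M = h2 M) ->
  cumul h1 N = cumul h2 N.
Proof. by move=> e; apply: eq_bigr => M _; apply: e. Qed.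

Lemma eq_run fs h1 h2 N : (forall M, (M <= N)%N -> h1 M = h2 M) ->
  run fs h1 N = run fs h2 N.
Proof.
elim: fs N => [|f fs IHfs] N e /=; first exact: e.
congr (_ * _); apply: eq_cumul => M ltMN; apply: IHfs => L leLM.
by apply: e; apply: leq_trans leLM (ltnW ltMN).
Qed.

Lemma cumul_sum (I : Type) (r : seq I) (h : I -> nat -> R) N :
  cumul (fun M => \sum_(i <- r) h i M) N = \sum_(i <- r) cumul (h i) N.
Proof. exact: exchange_big. Qed.

Lemma cumulZ c h N : cumul (fun M => c * h M) N = c * cumul h N.
Proof. by rewrite /cumul mulr_sumr. Qed.

(** Linearity in the seed, which carries the contribution of all the blocks with smaller summation
    indices. *)
Lemma run_sum fs (I : Type) (r : seq I) (h : I -> nat -> R) N :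
  run fs (fun M => \sum_(i <- r) h i M) N = \sum_(i <- r) run fs (h i) N.
Proof.
elim: fs N => [|f fs IHfs] N //=; rewrite -mulr_sumr -cumul_sum.
by congr (_ * _); apply: eq_cumul => M _; apply: IHfs.
Qed.

Lemma runZ fs c h N : run fs (fun M => c * h M) N = c * run fs h N.
Proof.
elim: fs N => [|f fs IHfs] N //=; rewrite mulrCA.
by congr (_ * _); rewrite -cumulZ; apply: eq_cumul => M _; apply: IHfs.
Qed.

Variables (p : nat) (u : nat -> R).
Hypothesis uK : forall N, (0 < N < p)%N -> u N * N%:R = 1.

(** [u N] stands for 1/N; it is kept abstract because the rings used later are polynomial rings over
    a prime field rather than fields. *)
Definition term (a : nzint) (N : nat) : R :=
  (sgz (val a))%:~R ^+ N * u N ^+ `|val a|%N.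

Lemma term_inc a N : term (inc_nz a) N = u N * term a N.
Proof. by rewrite /term sgz_inc_nz absz_inc_nz exprS mulrCA. Qed.

(** The factor [1 + (-1)^N] is the source of both the parity test and the factor 2 in [ecumul]. *)
Lemma term_pm1 N : term nz1 N + term nzN1 N = u N * if odd N then 0 else 2.
Proof.
rewrite /term /= (_ : sgz 1 = 1) // (_ : sgz (-1) = -1) //.
rewrite expr1n mul1r !expr1 -{1}[u N]mul1r -mulrDl mulrC.
by rewrite mulrN1z -signr_odd; case: odd; rewrite ?expr1 ?subrr.
Qed.

Definition indsum w n h N : R :=
  \sum_(a <- indices w n) run (map term a) h N.

Lemma indsum0 w h N : indsum w 0 h N = if w is 0 then h N else 0.
Proof. by rewrite /indsum indices0; case: w => [|w]; rewrite ?big_seq1 ?big_nil. Qed.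

Lemma indsum_small w n h N : (w < n)%N -> indsum w n h N = 0.
Proof. by move=> lt; rewrite /indsum indices_small // big_nil. Qed.

Lemma indsumS_0 w n h : indsum w n.+1 h 0 = 0.
Proof.
rewrite /indsum big_seq big1 // => -[|x b]; rewrite mem_indices //= => _.
by rewrite /cumul big_ord0 mulr0.
Qed.

(** Follows the recursion of [indices]: an increased head contributes a factor [u N], and the two
    heads 1 and -1 combine by [term_pm1]. *)
Lemma indsumSS w n h N :
  indsum w.+1 n.+1 h N = u N * (indsum w n.+1 h N + ecumul (indsum w n h) N).
Proof.
rewrite {1}/indsum /= !big_cat !big_map /= mulrDr; congr (_ + _).
  rewrite mulr_sumr; apply: eq_big_seq => -[|x b]; rewrite mem_indices //= => _.
  by rewrite term_inc mulrA.
rewrite -!mulr_sumr -mulrDl term_pm1 -mulrA /ecumul.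
case: ifP => _; first by rewrite mul0r.
by rewrite /indsum cumul_sum.
Qed.

Lemma indsum_rec w n h N : (N < p)%N ->
  N%:R * indsum w.+1 n.+1 h N =
  indsum w n.+1 h N + ecumul (indsum w n h) N.
Proof.
case: N => [|N] Np.
  by rewrite mul0r indsumS_0 /ecumul /cumul big_ord0 mulr0 addr0.
by rewrite indsumSS mulrA (mulrC N.+1%:R) uK // mul1r.
Qed.

Lemma indsum_odd w n h N : odd N -> indsum w n.+1 h N = 0.
Proof.
move=> oN; elim: w => [|w IHw]; first by rewrite /indsum big_nil.
by rewrite indsumSS IHw /ecumul oN addr0 mulr0.
Qed.

(* [gencoef l n m N] is the coefficient of bidegree (n, m) in the parameters of the
   generating series of the blocks in [l] (last block first), with largest
   summation index equal to [N]. *)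
Fixpoint gencoef (l : seq (R * R)) (n m : nat) : nat -> R :=
  if l is xy :: l' then fun N =>
    \sum_(i < n.+1) \sum_(j < m.+1) xy.1 ^+ i * xy.2 ^+ j *
       indsum (i + j).+1 i.+1 (gencoef l' (n - i) (m - j)) N
  else fun N => (n == 0)%:R * (m == 0)%:R * delta0 N.

(** The term [F_(l-1)] of the differential equation. *)
Definition Hpred (l : seq (R * R)) n m N : R :=
  if l is _ :: l' then gencoef l' n m N else 0.

Lemma H_cons0 xy l n m : gencoef (xy :: l) n m 0 = 0.
Proof. by rewrite /= !big1 // => i _; rewrite !big1 // => j _; rewrite indsumS_0 mulr0. Qed.

(** The differential equation, coefficient by coefficient. It comes from [indsum_rec] in the first
    block of the list: lowering the weight alone costs a factor y, lowering weight and length costs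
    a factor x or ends the block. *)
Lemma H_rec l n m N : (N < p)%N ->
  N%:R * gencoef l n m N = (head 0 l).2 * down2 (gencoef l) n m N +
    ecumul (fun M => (head 0 l).1 * down1 (gencoef l) n m M + Hpred l n m M) N.
Proof.
case: l => [|xy l] Np.
  (* For the empty list the default head is (0, 0), so the right side vanishes, and so does
     [N * delta0 N]. *)
  rewrite /= !mul0r add0r /ecumul /cumul; under eq_bigr do rewrite mul0r addr0.
  rewrite big1 // mulr0 if_same /delta0.
  by case: N {Np} => [|N]; rewrite ?mul0r //= !mulr0.
have -> : N%:R * gencoef (xy :: l) n m N =
  \sum_(i < n.+1) \sum_(j < m.+1) xy.1 ^+ i * xy.2 ^+ j *
       indsum (i + j) i.+1 (gencoef l (n - i) (m - j)) N +
  \sum_(i < n.+1) \sum_(j < m.+1) xy.1 ^+ i * xy.2 ^+ j *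
       ecumul (indsum (i + j) i (gencoef l (n - i) (m - j))) N.
  rewrite /= mulr_sumr -big_split; apply: eq_bigr => i _.
  rewrite mulr_sumr -big_split; apply: eq_bigr => j _.
  by rewrite mulrCA indsum_rec // mulrDr.
(* The terms with j = 0 vanish, their weight i being below their length i + 1; shifting j in the
   others extracts y. *)
congr (_ + _).
  case: m => [|m] /=.
    by rewrite big1 ?mulr0 // => i _; rewrite big_ord1 indsum_small ?mulr0 ?addn0.
  rewrite mulr_sumr; apply: eq_bigr => i _; rewrite big_ord_recl.
  rewrite indsum_small ?addn0 // mulr0 add0r mulr_sumr; apply: eq_bigr => j _.
  by rewrite /= /bump /= add1n addnS exprS !subSS; ring.
(* The term i = 0 has exhausted the block, so only j = 0 survives and gives [Hpred]; shifting i in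
   the others extracts x. *)
rewrite big_ord_recl ecumulD addrC; congr (_ + _); last first.
  rewrite big_ord_recl big1 ?addr0 => [|j _].
    rewrite !expr0 !mul1r; apply: eq_ecumul => M _.
    by rewrite indsum0 !subn0.
  by rewrite /ecumul /cumul !big1 ?mulr0 ?if_same ?mulr0 // => M _; rewrite indsum0.
case: n => [|n].
  rewrite big_ord0 /= /ecumul /cumul big1 ?mulr0 ?if_same // => M _; exact: mulr0.
rewrite [RHS]/= ecumulZ ecumul_sum mulr_sumr; apply: eq_bigr => i _.
rewrite ecumul_sum mulr_sumr; apply: eq_bigr => j _.
rewrite ecumulZ mulrA /= /bump /= add1n subSS addSn; congr (_ * _).
by rewrite exprS -mulrA.
Qed.

Lemma evensupp_H l : evensupp (gencoef l).
Proof.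
case: l => [|xy l] n m N oN /=; first by case: N oN => //= N _; rewrite mulr0.
by rewrite !big1 // => i _; rewrite big1 // => j _; rewrite indsum_odd ?mulr0.
Qed.

Lemma conv3_H0 F n m N : conv3 (gencoef [::]) F n m N = F n m N.
Proof.
rewrite /conv3 (bigD1 ord0) //= (bigD1 ord0) //= (bigD1 ord0) //=.
rewrite /delta0 !mulr1 mul1r !subn0 !big1 ?addr0 // => -[[|i] Hi] // _.
- by rewrite big1 // => j _; rewrite big1 // => M _; rewrite !mul0r.
- by rewrite big1 // => M _; rewrite mulr0 !mul0r.
- by rewrite mulr0 mul0r.
Qed.

(** The equation of the first factor multiplied by [G]; evenness of [G] lets [ecumul] pass through
    the product. *)
Lemma conv3_H_rec l G n m N : (N < p)%N -> evensupp G ->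
  conv3 (fun i j M => M%:R * gencoef l i j M) G n m N =
    (head 0 l).2 * down2 (conv3 (gencoef l) G) n m N +
    ecumul (fun M => (head 0 l).1 * down1 (conv3 (gencoef l) G) n m M +
                     conv3 (Hpred l) G n m M) N.
Proof.
move=> Np Gev.
pose F1 i j M := (head 0 l).1 * down1 (gencoef l) i j M + Hpred l i j M.
rewrite (@eq_conv3l _ _ (fun i j M => (head 0 l).2 * down2 (gencoef l) i j M +
    ecumul (F1 i j) M)); last first.
  by move=> i j M leMN; rewrite H_rec // (leq_ltn_trans leMN).
rewrite conv3Dl conv3Zl conv3_down2 conv3_ecumul //; congr (_ + _).
by apply: eq_ecumul => M _; rewrite conv3Dl conv3Zl conv3_down1.
Qed.

(* The fuel [k] is the total length of the two lists. *)
Fixpoint shuf (V : nmodType) k (v w : seq V) : seq (seq V) :=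
  if k is k'.+1 then
    map (cons (head 0 v + head 0 w))
      ((if v is _ :: v' then shuf k' v' w else [::]) ++
       (if w is _ :: w' then shuf k' v w' else [::]))
  else [:: [::]].

(** Both sides satisfy the same equation: the heads of [v] and [w] add up, and the lower term drops
    the head of one list or of the other. *)
Theorem sum_H_shuf k v w n m N : k = (size v + size w)%N -> (N < p)%N ->
  \sum_(l <- shuf k v w) gencoef l n m N = conv3 (gencoef v) (gencoef w) n m N.
Proof.
elim: k v w n m N => [|k IHk] v w n m N.
  by case: v w => [|? ?] [|? ?] // _ _; rewrite conv3_H0 big_seq1.
(* Inner induction on the total degree: apart from the shorter lists, which the outer induction
   covers, the equation involves only smaller bidegrees. *)
move=> kE; have [d] := ubnP (n + m); elim: d n m N => // d IHd n m N lt_nm_d Np.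
set S := fun n m N => \sum_(l <- shuf k.+1 v w) gencoef l n m N.
rewrite -/(S n m N); case: N Np => [|N] Np.
  rewrite /S /= big_map big1 => [|l _]; last exact: H_cons0.
  rewrite /conv3 big1 // => i _; rewrite big1 // => j _; rewrite big_ord1 subn0.
  case: v w kE {S IHd} => [|? ?] [|? ?] // _; by rewrite H_cons0 ?mul0r ?mulr0.
(* By [uK] the factor N + 1 can be cancelled for N + 1 < p. *)
suff key : N.+1%:R * S n m N.+1 = N.+1%:R * conv3 (gencoef v) (gencoef w) n m N.+1.
  by rewrite -[LHS]mul1r -[RHS]mul1r -(uK (N := N.+1)) // -!mulrA key.
rewrite conv3_deriv !conv3_H_rec //; try exact: evensupp_H.
(* All shuffles share the first entry [c]; [L] lists their tails. *)
pose c := head 0 v + head 0 w.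
pose L := (if v is _ :: v' then shuf k v' w else [::]) ++
          (if w is _ :: w' then shuf k v w' else [::]).
have SE n' m' N' : S n' m' N' = \sum_(l <- L) gencoef (c :: l) n' m' N'.
  by rewrite /S /= big_map.
have down1S N' : (N' < p)%N ->
    \sum_(l <- L) down1 (gencoef (c :: l)) n m N' = down1 (conv3 (gencoef v) (gencoef w)) n m N'.
  case: (n) lt_nm_d => [|n'] lt_d N'p; first by rewrite big1.
  by apply: etrans (IHd n' m N' _ N'p); rewrite -?/(S _ _ _) ?SE.
have down2S N' : (N' < p)%N ->
    \sum_(l <- L) down2 (gencoef (c :: l)) n m N' = down2 (conv3 (gencoef v) (gencoef w)) n m N'.
  case: (m) lt_nm_d => [|m'] lt_d N'p; first by rewrite big1.
  apply: etrans (IHd n m' N' _ N'p); first by rewrite -/(S _ _ _) SE.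
  by move: lt_d; rewrite addnS.
(* Removing [c] leaves a shuffle in which one list has lost its head: the outer induction
   applies. *)
have predS N' : (N' < p)%N -> \sum_(l <- L) gencoef l n m N' =
    conv3 (Hpred v) (gencoef w) n m N' + conv3 (gencoef v) (Hpred w) n m N'.
  have conv30 F : conv3 (fun _ _ _ => 0) F n m N' = 0 :> R.
    by rewrite /conv3 !big1 // => i _; rewrite !big1 // => j _; rewrite !big1 // => M _; rewrite mul0r.
  move=> N'p; rewrite big_cat /=; congr (_ + _).
    case: (v) kE => [|? v'] kE; first by rewrite big_nil conv30.
    by rewrite IHk //; case: kE.
  rewrite conv3C; case: (w) kE => [|? w'] kE; first by rewrite big_nil conv30.
  by rewrite IHk 1?conv3C //; move: kE; rewrite /= addnS => -[].
rewrite SE mulr_sumr.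
under eq_bigr do rewrite H_rec //= ecumulD ecumulZ.
rewrite !big_split /= -!mulr_sumr down2S // -!ecumul_sum.
rewrite (@eq_ecumul _ (fun M => \sum_(l <- L) down1 (gencoef (c :: l)) n m M)
  (down1 (conv3 (gencoef v) (gencoef w)) n m)); last first.
  by move=> M ltM; apply: down1S; apply: ltn_trans Np.
rewrite (@eq_ecumul _ (fun M => \sum_(l <- L) gencoef l n m M) (fun M => conv3 (Hpred v) (gencoef w) n m M +
   conv3 (gencoef v) (Hpred w) n m M)); last first.
  by move=> M ltM; apply: predS; apply: ltn_trans Np.
(* The Leibniz rule left the second product in the opposite order; it is now turned back. *)
have convHC n' m' N' : conv3 (gencoef w) (gencoef v) n' m' N' = conv3 (gencoef v) (gencoef w) n' m' N'.
  exact: conv3C.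
have -> : down2 (conv3 (gencoef w) (gencoef v)) n m N.+1 = down2 (conv3 (gencoef v) (gencoef w)) n m N.+1.
  by case: (m) => //= m'; rewrite convHC.
rewrite !ecumulD !ecumulZ.
rewrite [ecumul (down1 (conv3 (gencoef w) _) _ _) _](eq_ecumul (h2 := down1 (conv3 (gencoef v) (gencoef w)) n m)).
  rewrite [ecumul (conv3 (Hpred w) _ _ _) _](eq_ecumul (h2 := conv3 (gencoef v) (Hpred w) n m)).
    by rewrite /c /=; ring.
  by move=> M _; apply: conv3C.
by case: (n) => //= n' M _; rewrite convHC.
Qed.

End Run.

(** * Reflection m -> p - m *)

Section Nested.
Variables (R : comNzRingType) (p : nat).

(** Counterpart of [run] with the head of the list attached to the smallest index, which must exceed
    [b]. *)
Fixpoint nested (fs : seq (nat -> R)) (b : nat) : R :=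
  if fs is f :: fs' then \sum_(x < p | (b < x)%N) f x * nested fs' x else 1.

Lemma sum_run_nested fs h :
  \sum_(N < p) run (rev fs) h N = \sum_(b < p) h b * nested fs b.
Proof.
elim: fs h => [|f fs IHfs] h /=.
  by rewrite /rev /=; apply: eq_bigr => N _; rewrite mulr1.
rewrite rev_cons -cats1 run_cat IHfs /=.
under eq_bigr => b _ do rewrite /cumul (big_ord_widen_cond p xpredT h (ltnW (ltn_ord b))) /=
  mulr_sumr mulr_suml.
under [RHS]eq_bigr => b _ do rewrite mulr_sumr.
rewrite (exchange_big_dep xpredT) //=; apply: eq_bigr => M _.
by apply: eq_bigr => b _; rewrite -mulrA mulrCA.
Qed.

Definition refl (f : nat -> R) (L : nat) : R := f (p - L)%N.

(** The map x -> p - x reverses the order: the lower bound b becomes the upper bound p - b, and the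
    head passes from the smallest index to the largest, as [run] expects. *)
Lemma nested_refl fs b : (b < p)%N ->
  nested fs b = cumul (run (map refl fs) (delta0 R)) (p - b).
Proof.
elim: fs b => [|f fs IHfs] b bp /=.
  have: (0 < p - b)%N by rewrite subn_gt0.
  rewrite /cumul; case: (p - b)%N => // k _.
  by rewrite big_ord_recl big1 ?addr0.
under eq_bigr => x _ do rewrite IHfs //.
rewrite /cumul; set G := run _ _.
have -> : \sum_(x < p | (b < x)%N) f x * cumul G (p - x) =
          \sum_(b.+1 <= x < p) f x * cumul G (p - x) by rewrite big_geq_mkord.
rewrite -(big_mkord xpredT (fun L => refl f L * cumul G L)).
(* The reflected range also contains L = 0, that is x = p; its term vanishes because the inner sum
   is empty. *)
have cumul0 : cumul G 0 = 0 by rewrite /cumul big_ord0.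
rewrite [RHS]big_ltn ?subn_gt0 // cumul0 mulr0 add0r.
rewrite [RHS]big_nat_rev -[b.+1]add1n big_addn /=.
apply: eq_big_nat => i /andP[i1 i2].
by rewrite /refl; congr (f _ * cumul G _); lia.
Qed.

(** With M the last index of [fs] and L the reflected first index of [gs], the condition M < p - L
    reads M + L < p; hence a truncated product. *)
Lemma sum_run_cat fs gs :
  \sum_(N < p) run (rev (fs ++ gs)) (delta0 R) N =
  \sum_(N < p) \sum_(M < N.+1)
    run (rev fs) (delta0 R) M * run (map refl gs) (delta0 R) (N - M)%N.
Proof.
rewrite rev_cat run_cat sum_run_nested.
under eq_bigr => b _ do rewrite nested_refl //.
set F := run (rev fs) _; set G := run _ _.
have -> : \sum_(N < p) \sum_(M < N.+1) F M * G (N - M)%N =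
          \sum_(N < p) \sum_(M < N.+1) G M * F (N - M)%N.
  apply: eq_bigr => N _; rewrite (reindex_inj rev_ord_inj); apply: eq_bigr => M _ /=.
  by rewrite subSS subKn 1?mulrC // -ltnS.
rewrite -conv_cumul big_ord_recl {2}/cumul big_ord0 mul0r add0r.
rewrite (reindex_inj rev_ord_inj); apply: eq_bigr => M _ /=.
by rewrite mulrC subKn.
Qed.

End Nested.

Lemma zeta_p_nested (p : primeT) (a : seq nzint) (u := fun N => N%:R^-1 : 'F_(val p)) :
  zeta_p a p = \sum_(N < val p) run (rev (map (term u) a)) (delta0 _) N.
Proof.
have p_gt0 : (0 < val p)%N by rewrite prime_gt0 // (valP p).
rewrite sum_run_nested (bigD1 (Ordinal p_gt0)) //= big1 ?addr0; last first.
  by move=> -[[|i] Hi] // _; rewrite mul0r.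
rewrite mul1r /zeta_p.
(* A general lower bound [b] in place of 0 allows the smallest index to be peeled off by
   induction. *)
have E b : \sum_(m : (size a).-tuple 'I_(val p) | path ltn b [seq val x | x <- m])
  \prod_(i < size a) term u (tnth (in_tuple a) i) (val (tnth m i)) =
  nested (val p) (map (term u) a) b.
  elim: a b => [|x a IHa] b.
    rewrite (bigD1 [tuple]) //= big_ord0 big1 ?addr0 // => m.
    by case/andP=> _ /negP[]; apply/eqP; apply: tuple0.
  rewrite /= -(eq_bigr _ (fun y _ => congr1 (fun z => term u x (val y) * z) (IHa (val y)))).
  under [RHS]eq_bigr do rewrite mulr_sumr.
  rewrite pair_big_dep /=.
  rewrite (reindex (fun ym : 'I_(val p) * (size a).-tuple 'I_(val p) =>
      [tuple of ym.1 :: ym.2])) /=; last first.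
    exists (fun m => (thead m, [tuple of behead m])) => [[y m]|m] _ /=.
      by rewrite theadE; congr (_, _); apply: val_inj.
    by rewrite [RHS]tuple_eta.
  apply: eq_bigr => -[y m] _ /=; rewrite big_ord_recl /=; congr (_ * _).
  apply: eq_bigr => i _; rewrite !(tnth_nth x) /= !(tnth_nth y) /=.
  done.
rewrite -E; apply: eq_bigr => m _; apply: eq_bigr => i _.
by rewrite /term /u exprVn.
Qed.

Section Reflection.
Variables (R : comNzRingType) (p : nat) (u : nat -> R).
Hypotheses (p_odd : odd p) (pR0 : p%:R = 0 :> R).
Hypothesis uK : forall N, (0 < N < p)%N -> u N * N%:R = 1.

Lemma sgn_cons x b : sgn (x :: b) = sgz (val x) * sgn b.
Proof. by rewrite /sgn big_cons. Qed.

Lemma u_refl N : (0 < N < p)%N -> u (p - N)%N = - u N.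
Proof.
move=> Np; have pN : (0 < p - N < p)%N by lia.
rewrite -[RHS]mulr1 -(uK pN) natrB; last by lia.
by rewrite pR0 sub0r mulrCA mulrN mulNr opprK uK ?mulr1.
Qed.

(** Since p is odd, p - N + 1 and N have the same parity, which accounts for the sign of x; the
    powers of 1/(p - N) = -1/N give [(-1)^|x|]. *)
Lemma term_refl (x : nzint) N : (0 < N < p)%N ->
  (-1) ^+ `|val x|%N * (sgz (val x))%:~R * refl p (term u x) N = term u x N.
Proof.
move=> Np; rewrite /refl /term u_refl // -[- u N]mulN1r exprMn.
have sq : ((-1) ^+ `|val x|%N * (-1) ^+ `|val x|%N : R) = 1.
  by rewrite -exprD addnn -mul2n exprM sqrrN !expr1n.
have <- : (sgz (val x))%:~R * (sgz (val x))%:~R ^+ (p - N) = (sgz (val x))%:~R ^+ N :> R.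
  rewrite -exprS; case: (sgzP (val x)) (valP x) => [_ /eqP[]|_ _|_ _] //=.
    by rewrite !expr1n.
  rewrite mulrN1z -signr_odd -[RHS]signr_odd /= oddB; last by lia.
  by rewrite p_odd negbK.
by rewrite (mulrCA (_ ^+ (p - N))) mulrACA sq mul1r mulrA.
Qed.

Lemma run_refl a h N : (N < p)%N ->
  (-1) ^+ weight a * (sgn a)%:~R * run (map (refl p) (map (term u) a)) h N =
  run (map (term u) a) h N.
Proof.
elim: a N => [|x a IHa] N Np /=.
  by rewrite weight_nil /sgn big_nil !mul1r.
case: N Np => [|N] Np; first by rewrite /cumul !big_ord0 !mulr0.
rewrite weight_cons sgn_cons exprD intrM -(term_refl x (N := N.+1)) //.
rewrite (_ : cumul (run (map (term u) a) h) N.+1 =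
   (-1) ^+ weight a * (sgn a)%:~R * cumul (run (map (refl p) (map (term u) a)) h) N.+1).
  by ring.
rewrite -cumulZ; apply: eq_cumul => M ltMN; rewrite IHa //; exact: ltn_trans Np.
Qed.

End Reflection.

(** * Sums over families of blocks *)

Definition glue (T : Type) s t (a1 : {ffun 'I_s -> T}) (a2 : {ffun 'I_t -> T}) :
    {ffun 'I_(s + t) -> T} :=
  [ffun l => match fintype.split l with inl i => a1 i | inr j => a2 j end].

Lemma glue_l (T : Type) s t (a1 : {ffun 'I_s -> T}) (a2 : {ffun 'I_t -> T}) i :
  glue a1 a2 (lshift t i) = a1 i.
Proof. by rewrite ffunE (unsplitK (inl i)). Qed.

Lemma glue_r (T : Type) s t (a1 : {ffun 'I_s -> T}) (a2 : {ffun 'I_t -> T}) j :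
  glue a1 a2 (rshift s j) = a2 j.
Proof. by rewrite ffunE (unsplitK (inr j)). Qed.

Lemma glueK (T : Type) s t (a : {ffun 'I_(s + t) -> T}) :
  glue [ffun i => a (lshift t i)] [ffun j => a (rshift s j)] = a.
Proof.
by apply/ffunP => l; case: (split_ordP l) => i ->; rewrite ?glue_l ?glue_r ffunE.
Qed.

Lemma glue_inj (T : Type) s t (a1 b1 : {ffun 'I_s -> T}) (a2 b2 : {ffun 'I_t -> T}) :
  glue a1 a2 = glue b1 b2 -> a1 = b1 /\ a2 = b2.
Proof.
move=> e; split; apply/ffunP => i.
  by rewrite -(glue_l a1 a2) e glue_l.
by rewrite -(glue_r a1 a2) e glue_r.
Qed.

Lemma enum_addn s t : enum 'I_(s + t) =
  map (@lshift s t) (enum 'I_s) ++ map (@rshift s t) (enum 'I_t).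
Proof.
apply: (inj_map val_inj); rewrite map_cat val_enum_ord iotaD.
congr (_ ++ _).
  by rewrite -(map_comp _ (@lshift s t)) -val_enum_ord; apply: eq_map.
rewrite add0n -{1}[s]addn0 iotaDl -val_enum_ord.
by rewrite -(map_comp _ (@rshift s t)) -(map_comp (addn s)); apply: eq_map.
Qed.

Lemma map_rev_enum_addn1 (T : Type) N (f : 'I_(N + 1) -> T) :
  map f (rev (enum 'I_(N + 1))) =
  f (rshift N ord0) :: map (f \o @lshift N 1) (rev (enum 'I_N)).
Proof.
have e1 : enum 'I_1 = [:: ord0].
  by apply: (inj_map val_inj); rewrite val_enum_ord.
by rewrite enum_addn rev_cat map_cat e1 -(map_rev (@lshift N 1)) -(map_comp f).
Qed.

(** The predicate [P] allows the product structure to hold only on one class of a partition of [A],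
    as for the vectors with a given partial sum. *)
Lemma big_fset_set_glue (R : nmodType) (T : choiceType) s t
    (A : set {ffun 'I_(s + t) -> T}) (P : pred {ffun 'I_(s + t) -> T})
    (A1 : set {ffun 'I_s -> T}) (A2 : set {ffun 'I_t -> T})
    (F : {ffun 'I_(s + t) -> T} -> R) :
  finite_set A -> finite_set A1 -> finite_set A2 ->
  (forall a1 a2, A (glue a1 a2) /\ P (glue a1 a2) <-> A1 a1 /\ A2 a2) ->
  \sum_(a <- fset_set A | P a) F a =
  \sum_(a1 <- fset_set A1) \sum_(a2 <- fset_set A2) F (glue a1 a2).
Proof.
move=> fA fA1 fA2 AE.
transitivity (\sum_(a <- [seq glue z.1 z.2 |
    z <- [seq (a1, a2) | a1 <- fset_set A1, a2 <- fset_set A2]]) F a); last first.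
  by rewrite big_map big_allpairs.
rewrite -big_filter; apply: perm_big; apply: uniq_perm.
- by rewrite filter_uniq.
- rewrite map_inj_uniq; first by apply: allpairs_uniq => // -[? ?] [? ?].
  by move=> [a1 a2] [b1 b2] /= /glue_inj[-> ->].
move=> a; rewrite mem_filter in_fset_set //; apply/andP/mapP.
  case=> Pa; rewrite inE => Aa.
  have [] := (AE [ffun i => a (lshift t i)] [ffun j => a (rshift s j)]).1.
    by rewrite glueK.
  move=> A1a A2a; exists ([ffun i => a (lshift t i)], [ffun j => a (rshift s j)]).
    by apply: allpairs_f; rewrite in_fset_set // inE.
  by rewrite /= glueK.
case=> -[a1 a2] /allpairsP[[b1 b2] [/= + +]] [-> ->] ->.
rewrite !in_fset_set // !inE => A1b A2b /=.
by have [? ?] := (AE b1 b2).2 (conj A1b A2b); split=> //; apply: mem_set.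
Qed.

Lemma big_Zset_split (R : nmodType) s t n (F : {ffun 'I_(s + t) -> nat} -> R) :
  \sum_(r <- fset_set (Zset (s + t) n)) F r =
  \sum_(i < n.+1) \sum_(r1 <- fset_set (Zset s i))
    \sum_(r2 <- fset_set (Zset t (n - i))) F (glue r1 r2).
Proof.
pose lsum (r : {ffun 'I_(s + t) -> nat}) := (\sum_(i < s) r (lshift t i))%N.
(* The classes are the values of the partial sum; it is at most n, so [inord] is faithful. *)
rewrite (partition_big (fun r => inord (lsum r) : 'I_n.+1) xpredT) //=.
apply: eq_bigr => i _.
apply: big_fset_set_glue; rewrite ?finite_Zset //; try exact: finite_Zset.
move=> r1 r2; rewrite /Zset /= /lsum.
have -> : (\sum_(l < s + t) glue r1 r2 l = \sum_l r1 l + \sum_l r2 l)%N.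
  by rewrite big_split_ord /=; congr (_ + _)%N; apply: eq_bigr => l _; rewrite ?glue_l ?glue_r.
have -> : (\sum_(l < s) glue r1 r2 (lshift t l) = \sum_l r1 l)%N.
  by apply: eq_bigr => l _; rewrite glue_l.
split=> [[sumE /eqP iE]|[-> ->]].
  have {}iE : (\sum_l r1 l)%N = i by rewrite -iE inordK // ltnS -sumE leq_addr.
  by split=> //; rewrite -iE -{1}sumE addKn.
split; first by rewrite subnKC // -ltnS.
by apply/eqP; apply: val_inj; rewrite /= inordK.
Qed.

Lemma big_Sprod_split (R : nmodType) s t (r1 k1 : {ffun 'I_s -> nat})
    (r2 k2 : {ffun 'I_t -> nat}) (F : {ffun 'I_(s + t) -> seq nzint} -> R) :
  \sum_(a <- fset_set (Sprod (glue r1 r2) (glue k1 k2))) F a =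
  \sum_(a1 <- fset_set (Sprod r1 k1)) \sum_(a2 <- fset_set (Sprod r2 k2))
     F (glue a1 a2).
Proof.
apply: big_fset_set_glue; try exact: finite_Sprod.
move=> a1 a2; rewrite /Sprod /=; split.
  case=> Sa _; split=> l.
    by have := Sa (lshift t l); rewrite !glue_l.
  by have := Sa (rshift s l); rewrite !glue_r.
case=> S1 S2; split=> // l.
by case: (split_ordP l) => i ->; rewrite ?glue_l ?glue_r.
Qed.

Lemma big_Zset1 (R : nmodType) n (F : {ffun 'I_1 -> nat} -> R) :
  \sum_(r <- fset_set (Zset 1 n)) F r = F [ffun => n].
Proof.
transitivity (\sum_(r <- [:: [ffun => n] : {ffun 'I_1 -> nat}]) F r); last first.
  by rewrite big_seq1.
apply: perm_big; apply: uniq_perm => // r.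
rewrite in_fset_set; last exact: finite_Zset.
rewrite [in RHS]inE; apply/idP/eqP; rewrite inE /Zset /= big_ord1.
  by move=> <-; apply/ffunP => l; rewrite ffunE ord1.
by move=> ->; rewrite ffunE.
Qed.

Lemma big_Sprod1 (R : nmodType) i j (F : {ffun 'I_1 -> seq nzint} -> R) :
  \sum_(a <- fset_set (Sprod [ffun => i] [ffun => j])) F a =
  \sum_(b <- fset_set (Ssgn i j)) F [ffun => b].
Proof.
rewrite -(big_map (fun b : seq nzint => [ffun => b] : {ffun 'I_1 -> seq nzint}) xpredT F).
apply: perm_big; apply: uniq_perm => //.
  by rewrite map_inj_uniq ?fset_uniq // => b c /ffunP/(_ ord0); rewrite !ffunE.
move=> a; rewrite in_fset_set; last exact: finite_Sprod.
apply/idP/mapP; rewrite inE /Sprod /=.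
  move=> Sa; exists (a ord0); last by apply/ffunP => l; rewrite ffunE ord1.
  by rewrite in_fset_set ?inE; [have := Sa ord0; rewrite !ffunE | apply: finite_Ssgn].
case=> b; rewrite in_fset_set ?inE; last exact: finite_Ssgn.
by move=> Sb -> l; rewrite !ffunE.
Qed.

Section Family.
Variable R : comNzRingType.

(** The shape of each shuffle term on the right-hand side, over any ring and with an arbitrary
    summand in place of the zeta value. *)
Definition fam N n m (x y : 'I_N -> R) (Phi : {ffun 'I_N -> seq nzint} -> R) : R :=
  \sum_(r <- fset_set (Zset N n)) \sum_(k <- fset_set (Zset N m))
    (\prod_(l < N) (x l ^+ r l * y l ^+ k l)) * \sum_(a <- fset_set (Sprod r k)) Phi a.

Lemma eq_fam N n m x y Phi1 Phi2 : (forall a, Phi1 a = Phi2 a) ->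
  @fam N n m x y Phi1 = fam n m x y Phi2.
Proof.
move=> e; apply: eq_bigr => r _; apply: eq_bigr => k _; congr (_ * _).
by apply: eq_bigr => a _.
Qed.

(** A single sum over triples makes linearity in [Phi] immediate. *)
Lemma famE N n m x y Phi : @fam N n m x y Phi =
  \sum_(z <- [seq (z, a) | z <- [seq (r, k) | r <- fset_set (Zset N n), k <- fset_set (Zset N m)],
               a <- fset_set (Sprod z.1 z.2)])
    (\prod_(l < N) (x l ^+ z.1.1 l * y l ^+ z.1.2 l)) * Phi z.2.
Proof.
rewrite big_allpairs_dep big_allpairs; apply: eq_bigr => r _.
by apply: eq_bigr => k _; rewrite mulr_sumr.
Qed.

Lemma fam_sum N n m x y (I : Type) (s : seq I) Phi :
  @fam N n m x y (fun a => \sum_(i <- s) Phi i a) = \sum_(i <- s) fam n m x y (Phi i).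
Proof.
under [RHS]eq_bigr do rewrite famE.
rewrite famE exchange_big; apply: eq_bigr => z _; exact: mulr_sumr.
Qed.

Lemma famZ N n m x y c Phi :
  @fam N n m x y (fun a => c * Phi a) = c * fam n m x y Phi.
Proof. by rewrite !famE mulr_sumr; apply: eq_bigr => z _; rewrite mulrCA. Qed.

Lemma run_fam fs N n m x y Phi M :
  run fs (fun L => @fam N n m x y (fun a => Phi a L)) M =
  fam n m x y (fun a => run fs (Phi a) M).
Proof.
under eq_run => L _ do rewrite famE.
by rewrite run_sum famE; apply: eq_bigr => z _; rewrite runZ.
Qed.

Lemma fam_split s t n m (x y : 'I_(s + t) -> R) Phi :
  fam n m x y Phi = \sum_(i < n.+1) \sum_(j < m.+1)
    fam i j (x \o @lshift s t) (y \o @lshift s t) (fun a1 =>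
      fam (n - i) (m - j) (x \o @rshift s t) (y \o @rshift s t) (fun a2 =>
        Phi (glue a1 a2))).
Proof.
rewrite /fam big_Zset_split; apply: eq_bigr => i _.
under eq_bigr => r1 _.
  under eq_bigr => r2 _ do rewrite big_Zset_split.
  rewrite exchange_big /=; over.
rewrite exchange_big; apply: eq_bigr => j _.
apply: eq_bigr => r1 _; rewrite exchange_big; apply: eq_bigr => k1 _ /=.
rewrite [in RHS]exchange_big mulr_sumr; apply: eq_bigr => r2 _.
rewrite [in RHS]exchange_big mulr_sumr; apply: eq_bigr => k2 _.
rewrite -mulr_sumr big_Sprod_split mulrA; congr (_ * _).
rewrite big_split_ord /=; congr (_ * _); apply: eq_bigr => l _.
  by rewrite !glue_l.
by rewrite !glue_r.
Qed.

Lemma fam1 n m (x y : 'I_1 -> R) Phi :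
  fam n m x y Phi = x ord0 ^+ n * y ord0 ^+ m *
    \sum_(b <- indices (n + m).+1 n.+1) Phi [ffun => b].
Proof. by rewrite /fam !big_Zset1 big_ord1 !ffunE big_Sprod1 big_indices. Qed.

Lemma fam0 n m (x y : 'I_0 -> R) Phi :
  fam n m x y Phi = (n == 0%N)%:R * (m == 0%N)%:R * Phi [ffun => [::]].
Proof.
have e0 (T : choiceType) (c : T) (f : {ffun 'I_0 -> T}) : f = [ffun => c].
  by apply/ffunP => -[].
have Z0 k (F : {ffun 'I_0 -> nat} -> R) :
    \sum_(r <- fset_set (Zset 0 k)) F r = (k == 0%N)%:R * F [ffun => 0%N].
  case: k => [|k].
    transitivity (\sum_(r <- [:: [ffun => 0%N] : {ffun 'I_0 -> nat}]) F r); last first.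
      by rewrite big_seq1 mul1r.
    apply: perm_big; apply: uniq_perm => // r.
    rewrite in_fset_set; last exact: finite_Zset.
    rewrite [in RHS]inE (e0 _ 0%N r) eqxx; apply/idP.
    by rewrite inE /Zset /= big_ord0.
  rewrite mul0r big_seq big1 // => r; rewrite in_fset_set; last exact: finite_Zset.
  by rewrite inE /Zset /= big_ord0.
rewrite /fam !Z0 -mulrA big_ord0 mul1r; congr (_ * (_ * _)).
transitivity (\sum_(a <- [:: [ffun => [::]] : {ffun 'I_0 -> seq nzint}]) Phi a); last first.
  by rewrite big_seq1.
apply: perm_big; apply: uniq_perm => // a.
rewrite in_fset_set; last exact: finite_Sprod.
rewrite [in RHS]inE (e0 _ [::] a) eqxx; apply/idP.
by rewrite inE /Sprod /= => -[].
Qed.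

Variables (u : nat -> R).

(* [g] is the identity or [rev]: both orders inside a block occur. *)
Lemma fam_H (g : seq nzint -> seq nzint) N n m (x y : 'I_N -> R) M :
  (forall w n, perm_eq (map g (indices w n)) (indices w n)) ->
  fam n m x y (fun a => run
    (map (term u) (flatten [seq g (a l) | l <- rev (enum 'I_N)])) (delta0 R) M) =
  gencoef u [seq (x l, y l) | l <- rev (enum 'I_N)] n m M.
Proof.
move=> gP; elim: N n m x y M => [|N IHN] n m x y M.
  by rewrite fam0 !(size0nil (size_enum_ord 0)).
move: x y; rewrite -addn1 => x y.
rewrite fam_split map_rev_enum_addn1.
(* [fam_split] sums over the degree of the first N blocks, [gencoef] over that of the last block;
   the two are complementary. *)
rewrite /= (reindex_inj rev_ord_inj); apply: eq_bigr => i _.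
rewrite (reindex_inj rev_ord_inj); apply: eq_bigr => j _ /=.
rewrite !subSS !subKn -1?ltnS //.
under eq_fam => a1.
  rewrite fam1 /=; under eq_bigr => b _.
    rewrite map_rev_enum_addn1 /= glue_r ffunE map_cat run_cat.
    under [X in flatten X]eq_map => l do rewrite /= glue_l.
    over.
  over.
rewrite famZ fam_sum; congr (_ * _).
rewrite /indsum -[RHS](perm_big _ (gP _ _)) big_map; apply: eq_bigr => b _.
by rewrite -run_fam; apply: eq_run => L _; rewrite IHN.
Qed.

End Family.

(** * Shuffle permutations and words *)

Section ShuffleWords.
Variable V : nmodType.

(** Words with s letters [false] and t letters [true], read from the last position of the shuffle to
    the first, as in [gencoef]. *)
Fixpoint swords k (s t : nat) : seq (seq bool) :=
  if k is k'.+1 then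
    (if s is s'.+1 then map (cons false) (swords k' s' t) else [::]) ++
    (if t is t'.+1 then map (cons true) (swords k' s t') else [::])
  else [:: [::]].

(** The parameters met along the lattice path coded by [b]; an exhausted list contributes 0. *)
Fixpoint pathsum (v w : seq V) (b : seq bool) : seq V :=
  if b is c :: b' then (head 0 v + head 0 w) ::
    (if c then pathsum v (behead w) b' else pathsum (behead v) w b')
  else [::].

Lemma shufE k v w : shuf k v w = map (pathsum v w) (swords k (size v) (size w)).
Proof.
elim: k v w => [|k IHk] v w //=; rewrite !map_cat; congr (_ ++ _).
  by case: v => [|a v] //=; rewrite IHk -!map_comp.
by case: w => [|a w] //=; rewrite IHk -!map_comp.
Qed.

Lemma mem_swords k s t b : k = (s + t)%N ->
  (b \in swords k s t) = (size b == k) && (count id b == t).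
Proof.
have memC (c d : bool) b' l : (c :: b' \in map (cons d) l) = (c == d) && (b' \in l).
  apply/mapP/andP => [[e el [-> ->]]|[/eqP-> bl]]; first by rewrite eqxx.
  by exists b'.
elim: k s t b => [|k IHk] s t b kE /=.
  by case: s t kE => [|s] [|t] // _; rewrite inE; case: b.
rewrite mem_cat; case: b => [|c b].
  by apply/negbTE; rewrite negb_or; apply/andP; split; [case: s kE|case: t kE] => // ? _;
     apply/mapP => -[].
have -> : (c :: b \in (if s is s'.+1 then map (cons false) (swords k s' t) else [::])) =
    [&& ~~ c, size b == k & count id b == t].
  case: s kE => [|s] kE; last by rewrite memC IHk ?eqbF_neg //; lia.
  rewrite in_nil; apply/esym/negbTE/negP => /and3P[_ /eqP sb /eqP cb].
  by have := count_size id b; rewrite sb cb -[t]/(0 + t)%N -kE ltnn.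
have -> : (c :: b \in (if t is t'.+1 then map (cons true) (swords k s t') else [::])) =
    [&& c, size b == k & (count id b).+1 == t].
  case: t kE => [|t] kE; last by rewrite memC IHk ?eqb_id //; lia.
  by rewrite in_nil !andbF.
by case: c => /=; rewrite ?add1n ?add0n ?orbF eqSS.
Qed.

Lemma uniq_swords k s t : uniq (swords k s t).
Proof.
elim: k s t => [|k IHk] s t //=.
have cinj c : injective (cons c : seq bool -> _) by move=> a b [].
rewrite cat_uniq; apply/and3P; split.
- by case: s => // s; rewrite (map_inj_uniq (cinj _)).
- apply/hasPn => b; case: t => // t /mapP[b' _ ->]; case: s => // s.
  by apply/mapP => -[].
- by case: t => // t; rewrite (map_inj_uniq (cinj _)).
Qed.

Definition shift0 (x : nat -> V) (i : nat) : V := if i is i'.+1 then x i' else 0.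

(** At position i the path carries the latest entry of each list reached so far; [shift0] gives 0
    when there is none yet. *)
Lemma pathsum_mkseq (x y : nat -> V) (B : nat -> bool) k
    (c0 := fun k => count (predC B) (iota 0 k)) (c1 := fun k => count B (iota 0 k)) :
  pathsum (rev (mkseq x (c0 k))) (rev (mkseq y (c1 k))) (rev (mkseq B k)) =
  rev (mkseq (fun i => shift0 x (c0 i.+1) + shift0 y (c1 i.+1)) k).
Proof.
have headE (z : nat -> V) n : head 0 (rev (mkseq z n)) = shift0 z n.
  by case: n => [|n] //; rewrite mkseqS rev_rcons.
have beheadE (z : nat -> V) n : behead (rev (mkseq z n.+1)) = rev (mkseq z n).
  by rewrite mkseqS rev_rcons.
elim: k => [|k IHk] //.
rewrite [in X in pathsum _ _ X]mkseqS [in RHS]mkseqS !rev_rcons /= !headE.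
congr (_ :: _); rewrite -{}IHk.
have c0S : c0 k.+1 = (c0 k + ~~ B k)%N by rewrite /c0 -addn1 iotaD count_cat /= addn0.
have c1S : c1 k.+1 = (c1 k + B k)%N by rewrite /c1 -addn1 iotaD count_cat /= addn0.
by rewrite c0S c1S; case: (B k); rewrite /= ?addn0 ?addn1 ?beheadE.
Qed.

(** The intervals from f j to f (j + 1) tile the range from f 0 to f s, so at most one contains i,
    and counting the left ends up to i identifies it. *)
Lemma sum_between (f : nat -> nat) (x : nat -> V) i s :
  (forall j, (j < s)%N -> (f j <= f j.+1)%N) ->
  \sum_(j < s | (f j <= i < f j.+1)%N) x j =
  if (i < f s)%N then shift0 x (count (fun j => f j <= i)%N (iota 0 s)) else 0.
Proof.
elim: s => [|s IHs] fmono; first by rewrite big_ord0 if_same.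
have fmono' j : (j < s)%N -> (f j <= f j.+1)%N by move=> js; apply: fmono; apply: ltnW.
have -> : iota 0 s.+1 = iota 0 s ++ [:: s] by rewrite -addn1 iotaD.
rewrite big_mkcond big_ord_recr -big_mkcond IHs //= count_cat /= addn0.
have [lt_i|le_i] := ltnP i (f s).
  by rewrite (leq_trans lt_i (fmono _ _)) // addr0 addn0.
rewrite add0r (_ : count _ _ = s) ?addn1 //.
apply/eqP; rewrite -[X in _ == X](size_iota 0 s) -all_count; apply/allP => j.
rewrite mem_iota add0n => /andP[_ js]; apply: leq_trans le_i.
elim: s fmono' js {IHs fmono} => // s IHs fmono'.
rewrite ltnS leq_eqVlt => /predU1P[->|js]; first exact: fmono'.
by apply: leq_trans (fmono' s _) => //; apply: IHs => // k ks; apply: fmono'; apply: ltnW.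
Qed.

End ShuffleWords.

Lemma map_rev_enum (T : Type) n (f : 'I_n -> T) (g : nat -> T) :
  (forall i : 'I_n, f i = g i) -> map f (rev (enum 'I_n)) = rev (mkseq g n).
Proof.
move=> e; rewrite (map_rev f) /mkseq -val_enum_ord -(map_comp g val).
by congr (rev _); apply: eq_map.
Qed.

(** * The permutations in [Wset] and their words *)

Section Shuffles.
Variables (s t : nat).
Implicit Types sigma tau : 'S_(s + t).

(** The letter at position k tells which of the two groups of blocks fills it: [true] for the last
    t. *)
Definition word_of sigma (k : nat) : bool :=
  oapp (fun i : 'I_(s + t) => (s <= sigma^-1%g i)%N) false (insub k).

Definition sword sigma : seq bool := rev (mkseq (word_of sigma) (s + t)).

Lemma word_ofE sigma (i : 'I_(s + t)) : word_of sigma i = (s <= sigma^-1%g i)%N.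
Proof. by rewrite /word_of valK. Qed.

(* Continued by [s + t], so that [e_end] is always the next position. *)
Definition lpos sigma (j : nat) : nat :=
  oapp (fun j : 'I_s => sigma (lshift t j) : nat) (s + t)%N (insub j).
Definition rpos sigma (j : nat) : nat :=
  oapp (fun j : 'I_t => sigma (rshift s j) : nat) (s + t)%N (insub j).

Lemma lposE sigma (j : 'I_s) : lpos sigma j = sigma (lshift t j).
Proof. by rewrite /lpos valK. Qed.
Lemma rposE sigma (j : 'I_t) : rpos sigma j = sigma (rshift s j).
Proof. by rewrite /rpos valK. Qed.

Lemma lpos_end sigma : lpos sigma s = (s + t)%N.
Proof. by rewrite /lpos insubF ?ltnn. Qed.
Lemma rpos_end sigma : rpos sigma t = (s + t)%N.
Proof. by rewrite /rpos insubF ?ltnn. Qed.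

Lemma e_end_l sigma (j : 'I_s) : e_end sigma (lshift t j) = lpos sigma j.+1.
Proof.
rewrite /e_end /lpos; case: insubP => [j' _ ej'|] /=; last first.
  by move=> h; rewrite insubF //; apply/negbTE; move: h; rewrite -!leqNgt; apply: leq_trans; apply: leq_addr.
case: ifP => [/eqP->|js]; first by rewrite insubF ?ltnn.
have js' : (j.+1 < s)%N by rewrite ltn_neqAle js ltn_ord.
rewrite insubT /=; congr (nat_of_ord (sigma _)); exact: val_inj.
Qed.

Lemma e_end_r sigma (j : 'I_t) : e_end sigma (rshift s j) = rpos sigma j.+1.
Proof.
rewrite /e_end /rpos; case: insubP => [j' + ej'|] /=; last first.
  by rewrite -addnS ltn_add2l => /negbTE h; rewrite insubF.
rewrite -addnS ltn_add2l => jt; rewrite insubT.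
rewrite (_ : (s + j.+1)%N == s = false); last by lia.
by congr (nat_of_ord (sigma _)); apply: val_inj; rewrite ej' /= addnS.
Qed.

Lemma WsetP sigma : reflect
  ((forall i j : 'I_s, (i < j)%N -> (sigma (lshift t i) < sigma (lshift t j))%N) /\
   (forall i j : 'I_t, (i < j)%N -> (sigma (rshift s i) < sigma (rshift s j))%N))
  (sigma \in Wset s t).
Proof.
rewrite inE; apply: (iffP andP) => -[Wl Wr]; split.
- by move=> i j; move/forallP/(_ i)/forallP/(_ j)/implyP: Wl.
- by move=> i j; move/forallP/(_ i)/forallP/(_ j)/implyP: Wr.
- by apply/forallP => i; apply/forallP => j; apply/implyP; apply: Wl.
- by apply/forallP => i; apply/forallP => j; apply/implyP; apply: Wr.
Qed.

Lemma lpos_mono sigma j : sigma \in Wset s t -> (j < s)%N ->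
  (lpos sigma j <= lpos sigma j.+1)%N.
Proof.
move=> /WsetP[Wl _] js; rewrite (lposE _ (Ordinal js)).
rewrite /lpos; case: insubP => [j' _ /= ej'|_]; last exact: ltnW.
by apply/ltnW/Wl; rewrite ej'.
Qed.

Lemma rpos_mono sigma j : sigma \in Wset s t -> (j < t)%N ->
  (rpos sigma j <= rpos sigma j.+1)%N.
Proof.
move=> /WsetP[_ Wr] jt; rewrite (rposE _ (Ordinal jt)).
rewrite /rpos; case: insubP => [j' _ /= ej'|_]; last exact: ltnW.
by apply/ltnW/Wr; rewrite ej'.
Qed.

Lemma count_iota_ord (P : pred nat) n : count P (iota 0 n) = (\sum_(i < n) P i)%N.
Proof. by rewrite -sum1_count big_mkcond -[X in iota _ X]subn0 big_mkord. Qed.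

(** Reindexing along [sigma] turns the count of letters into a count of the images of the second
    group. *)
Lemma count_word sigma (P : pred nat) (k : nat) : (k <= s + t)%N ->
  (forall i : 'I_(s + t), P i = word_of sigma i) ->
  count P (iota 0 k) = count (fun j => rpos sigma j < k)%N (iota 0 t).
Proof.
move=> kst PE; rewrite !count_iota_ord.
transitivity (\sum_(i < s + t) (i < k) * P i)%N.
  rewrite (big_ord_widen _ (fun i => nat_of_bool (P i)) kst) big_mkcond.
  by apply: eq_bigr => i _; case: (i < k)%N; rewrite ?mul1n.
rewrite (reindex_inj (@perm_inj _ sigma)) big_split_ord /= big1 ?add0n => [|j _].
  apply: eq_bigr => j _; rewrite PE word_ofE permK /= leq_addr muln1.
  by rewrite rposE.
by rewrite PE word_ofE permK /= [(s <= _)%N]leqNgt ltn_ord muln0.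
Qed.

Lemma count_wordC sigma (P : pred nat) (k : nat) : (k <= s + t)%N ->
  (forall i : 'I_(s + t), P i = ~~ word_of sigma i) ->
  count P (iota 0 k) = count (fun j => lpos sigma j < k)%N (iota 0 s).
Proof.
move=> kst PE; rewrite !count_iota_ord.
transitivity (\sum_(i < s + t) (i < k) * P i)%N.
  rewrite (big_ord_widen _ (fun i => nat_of_bool (P i)) kst) big_mkcond.
  by apply: eq_bigr => i _; case: (i < k)%N; rewrite ?mul1n.
rewrite (reindex_inj (@perm_inj _ sigma)) big_split_ord /= [X in (_ + X)%N]big1 ?addn0 => [|j _].
  apply: eq_bigr => j _; rewrite PE word_ofE permK /= -ltnNge ltn_ord muln1.
  by rewrite lposE.
by rewrite PE word_ofE permK /= leq_addr muln0.
Qed.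

Lemma count_lpos sigma : count (fun j => lpos sigma j < s + t)%N (iota 0 s) = s.
Proof.
apply/eqP; rewrite -[X in _ == X](size_iota 0 s) -all_count; apply/allP => j.
by rewrite mem_iota add0n => /andP[_ js]; rewrite (lposE _ (Ordinal js)).
Qed.

Lemma count_rpos sigma : count (fun j => rpos sigma j < s + t)%N (iota 0 t) = t.
Proof.
apply/eqP; rewrite -[X in _ == X](size_iota 0 t) -all_count; apply/allP => j.
by rewrite mem_iota add0n => /andP[_ jt]; rewrite (rposE _ (Ordinal jt)).
Qed.

(** Within each group the intervals from [sigma j] to [e_end sigma j] tile, up to s + t, so the
    linear form at i is the latest parameter of the first group plus that of the second. *)
Lemma Pform_pathsum (V : nmodType) sigma (x : 'I_(s + t) -> V) :
  sigma \in Wset s t ->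
  [seq Pform sigma x i | i <- rev (enum 'I_(s + t))] =
  pathsum [seq x (lshift t i) | i <- rev (enum 'I_s)]
          [seq x (rshift s j) | j <- rev (enum 'I_t)] (sword sigma).
Proof.
move=> sW.
pose xl j := oapp (fun j : 'I_s => x (lshift t j)) 0 (insub j).
pose xr j := oapp (fun j : 'I_t => x (rshift s j)) 0 (insub j).
pose B := word_of sigma.
rewrite (@map_rev_enum _ _ (fun i => x (lshift t i)) xl); last by move=> i; rewrite /xl valK.
rewrite (@map_rev_enum _ _ (fun i => x (rshift s i)) xr); last by move=> i; rewrite /xr valK.
have sE : s = count (predC B) (iota 0 (s + t)).
  by rewrite (@count_wordC sigma) // count_lpos.
have tE : t = count B (iota 0 (s + t)) by rewrite (@count_word sigma) // count_rpos.
rewrite [in mkseq xl _]sE [in mkseq xr _]tE pathsum_mkseq.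
apply: map_rev_enum => i.
rewrite (@count_wordC sigma (predC B)) // (@count_word sigma B) //.
rewrite /Pform big_mkcond big_split_ord /= -!big_mkcond /=; congr (_ + _).
  transitivity (if (i < lpos sigma s)%N
      then shift0 xl (count (fun j => lpos sigma j <= i)%N (iota 0 s)) else 0).
    rewrite -sum_between => [|j]; last exact: lpos_mono.
    by apply: eq_big => j; rewrite ?lposE ?e_end_l // /xl valK.
  by rewrite lpos_end ltn_ord.
transitivity (if (i < rpos sigma t)%N
    then shift0 xr (count (fun j => rpos sigma j <= i)%N (iota 0 t)) else 0).
  rewrite -sum_between => [|j]; last exact: rpos_mono.
  by apply: eq_big => j; rewrite ?rposE ?e_end_r // /xr valK.
by rewrite rpos_end ltn_ord.
Qed.

Lemma sword_mem sigma : sword sigma \in swords (s + t) s t.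
Proof.
rewrite mem_swords // size_rev size_mkseq eqxx /= /sword count_rev /mkseq count_map.
by rewrite (@count_word sigma) // count_rpos.
Qed.

(** On each group [sigma] is increasing, so its values are the positions with the corresponding
    letter, in increasing order; the word thus determines [sigma]. *)
Lemma perm_Wset sigma : sigma \in Wset s t ->
  [seq sigma i | i <- enum 'I_(s + t)] =
  [seq i : 'I_(s + t) <- enum 'I_(s + t) | ~~ word_of sigma i] ++
  [seq i : 'I_(s + t) <- enum 'I_(s + t) | word_of sigma i].
Proof.
move=> /WsetP[Wl Wr]; rewrite {1}enum_addn map_cat.
pose lt N := relpre (@nat_of_ord N) ltn.
have lt_tr N : transitive (lt N) by move=> j i k; apply: ltn_trans.
have lt_irr N : irreflexive (lt N) by move=> i; apply: ltnn.
have sorted_enum N : sorted (lt N) (enum 'I_N).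
  by rewrite -sorted_map val_enum_ord iota_ltn_sorted.
congr (_ ++ _); apply: (irr_sorted_eq (lt_tr _) (lt_irr _)).
- rewrite -(map_comp _ (@lshift s t)) sorted_map.
  by apply: sub_sorted (sorted_enum s) => i j; apply: Wl.
- exact: (sorted_filter (@lt_tr _)).
- move=> i; rewrite mem_filter mem_enum andbT word_ofE -ltnNge.
  rewrite -(map_comp _ (@lshift s t)); apply/mapP/idP => [[j _ ->]|lt_is] /=.
    by rewrite permK /= ltn_ord.
  exists (Ordinal lt_is); rewrite ?mem_enum //=.
  by rewrite -[LHS](permKV sigma); congr (sigma _); apply: val_inj.
- rewrite -(map_comp _ (@rshift s t)) sorted_map.
  by apply: sub_sorted (sorted_enum t) => i j; apply: Wr.
- exact: (sorted_filter (@lt_tr _)).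
- move=> i; rewrite mem_filter mem_enum andbT word_ofE.
  rewrite -(map_comp _ (@rshift s t)); apply/mapP/idP => [[j _ ->]|le_is] /=.
    by rewrite permK leq_addr.
  have lt_it : (sigma^-1%g i - s < t)%N by have := ltn_ord (sigma^-1%g i); lia.
  exists (Ordinal lt_it); rewrite ?mem_enum //=.
  by rewrite -[LHS](permKV sigma); congr (sigma _); apply: val_inj; rewrite /= subnKC.
Qed.

Lemma sword_inj : {in Wset s t &, injective sword}.
Proof.
move=> sigma tau sW tW /(can_inj revK) e.
have {}e i : (i < s + t)%N -> word_of sigma i = word_of tau i.
  by move=> ist; rewrite -(nth_mkseq false (word_of sigma) ist) e nth_mkseq.
have : [seq sigma i | i <- enum 'I_(s + t)] = [seq tau i | i <- enum 'I_(s + t)].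
  rewrite !perm_Wset //; congr (_ ++ _); apply: eq_filter => i; rewrite e //.
by move/eq_in_map => {}e; apply/permP => i; apply: e; rewrite mem_enum.
Qed.

Lemma sword_surj b : b \in swords (s + t) s t ->
  exists2 sigma, sigma \in Wset s t & sword sigma = b.
Proof.
rewrite mem_swords // => /andP[/eqP sb /eqP cb].
pose B (i : nat) := nth false (rev b) i.
have bE : rev b = mkseq B (s + t) by rewrite -sb -size_rev mkseq_nth.
pose L0 := [seq i : 'I_(s + t) <- enum 'I_(s + t) | ~~ B i].
pose L1 := [seq i : 'I_(s + t) <- enum 'I_(s + t) | B i].
have szL1 : size L1 = t.
  apply: etrans cb; rewrite size_filter -(count_map val B) val_enum_ord.
  by rewrite -(count_rev id b) bE /mkseq count_map.
have szL0 : size L0 = s.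
  have := count_predC (fun i : 'I_(s + t) => B i) (enum 'I_(s + t)).
  by rewrite -!size_filter -/L1 szL1 size_enum_ord -/L0 => h; apply/eqP; rewrite -(eqn_add2l t) h addnC.
have szL : size (L0 ++ L1) == (s + t)%N by rewrite size_cat szL0 szL1.
have Luniq : uniq (Tuple szL).
  rewrite /= cat_uniq; apply/and3P; split; try exact: filter_uniq (enum_uniq _).
  by apply/hasPn => i; rewrite mem_filter => /andP[Bi _]; rewrite /= mem_filter Bi.
(* The permutation sends the first group to the [false] positions and the second to the [true] ones,
   both increasingly. *)
pose sigma := perm (elimT (tuple_uniqP _) Luniq).
have sl (i : 'I_s) x0 : sigma (lshift t i) = nth x0 L0 i.
  by rewrite permE (tnth_nth x0) nth_cat szL0 /= ltn_ord.
have sr (i : 'I_t) x0 : sigma (rshift s i) = nth x0 L1 i.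
  by rewrite permE (tnth_nth x0) nth_cat szL0 /= ltnNge leq_addr addKn.
have lt_tr : transitive (relpre (@nat_of_ord (s + t)) ltn).
  by move=> j i k; apply: ltn_trans.
have sorted_enum : sorted (relpre (@nat_of_ord (s + t)) ltn) (enum 'I_(s + t)).
  by rewrite -sorted_map val_enum_ord iota_ltn_sorted.
exists sigma.
  apply/WsetP; split=> i j ij.
    rewrite (sl i (sigma (lshift t i))) (sl j (sigma (lshift t i))).
    apply: (sorted_ltn_nth lt_tr); rewrite ?inE ?szL0 //.
    exact: (sorted_filter lt_tr).
  rewrite (sr i (sigma (rshift s i))) (sr j (sigma (rshift s i))).
  apply: (sorted_ltn_nth lt_tr); rewrite ?inE ?szL1 //.
  exact: (sorted_filter lt_tr).
rewrite /sword -[b]revK bE; congr (rev _); apply/eq_in_map => i.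
rewrite mem_iota add0n => /andP[_ ist]; rewrite (word_ofE _ (Ordinal ist)).
set o := Ordinal ist; rewrite -[i]/(val o) -{2}(permKV sigma o).
case: (split_ordP (sigma^-1%g o)) => j ->.
  have : sigma (lshift t j) \in L0 by rewrite (sl j o) mem_nth // szL0.
  by rewrite mem_filter /= leqNgt ltn_ord => /andP[/negbTE->].
have : sigma (rshift s j) \in L1 by rewrite (sr j o) mem_nth // szL1.
by rewrite mem_filter leq_addr => /andP[->].
Qed.

Lemma sum_Wset (R V : nmodType) (x : 'I_(s + t) -> V) (Phi : seq V -> R) :
  \sum_(sigma in Wset s t) Phi [seq Pform sigma x i | i <- rev (enum 'I_(s + t))] =
  \sum_(l <- shuf (s + t) [seq x (lshift t i) | i <- rev (enum 'I_s)]
                          [seq x (rshift s j) | j <- rev (enum 'I_t)]) Phi l.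
Proof.
under eq_bigr => sigma sW do rewrite Pform_pathsum //.
rewrite shufE big_map !size_map !size_rev !size_enum_ord -big_enum /=.
rewrite -(big_map sword xpredT (fun b => Phi (pathsum _ _ b))).
apply: perm_big; apply: uniq_perm; rewrite ?uniq_swords //.
  by rewrite map_inj_in_uniq ?enum_uniq // => u v; rewrite !mem_enum; apply: sword_inj.
move=> b; apply/mapP/idP => [[sigma _ ->]|/sword_surj[sigma sW <-]].
  exact: sword_mem.
by exists sigma; rewrite ?mem_enum.
Qed.

End Shuffles.

(** * Comparison in the finite fields and transfer to the quotient ring *)

(** Lets one shuffle of pairs carry the parameters lambda and mu together. *)
Lemma Pform_pair (U V : nmodType) s t (sigma : 'S_(s + t)) (x : 'I_(s + t) -> U)
    (y : 'I_(s + t) -> V) i :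
  Pform sigma (fun l => (x l, y l)) i = (Pform sigma x i, Pform sigma y i).
Proof. by rewrite /Pform; elim/big_rec3: _ => //= j a b c _ ->. Qed.

Lemma rmorph_Pform (R S : pzRingType) (f : {rmorphism R -> S}) s t
    (sigma : 'S_(s + t)) (x : 'I_(s + t) -> R) i :
  f (Pform sigma x i) = Pform sigma (f \o x) i.
Proof. exact: rmorph_sum. Qed.

Section Sides.
Variables (s t n m : nat).

(** Abstract ring, parameters and zeta values, so that the identity can be carried along ring
    morphisms; [rhs_ring] is its counterpart. *)
Definition lhs_ring (R : comNzRingType) (x y : 'I_(s + t) -> R) (z : seq nzint -> R) : R :=
  \sum_(r <- fset_set (Zset (s + t) n)) \sum_(k <- fset_set (Zset (s + t) m))
     (-1) ^+ q_exp r k * (\prod_(l < s + t) (x l ^+ r l * y l ^+ k l))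
     * \sum_(a <- fset_set (Sprod r k))
          (\prod_(v < t) sgn (a (rshift s v)))%:~R * z (concat_rev a).

Definition rhs_ring (R : comNzRingType) (x y : 'I_(s + t) -> R) (z : seq nzint -> R) : R :=
  \sum_(sigma in Wset s t)
    fam n m (Pform sigma x) (Pform sigma y) (fun a => z (concat a)).

Variables (R S : comNzRingType) (f : {rmorphism R -> S}).
Variables (x y : 'I_(s + t) -> R) (z : seq nzint -> R).

Lemma rmorph_lhs : f (lhs_ring x y z) = lhs_ring (f \o x) (f \o y) (f \o z).
Proof.
rewrite rmorph_sum; apply: eq_bigr => r _; rewrite rmorph_sum; apply: eq_bigr => k _.
rewrite !rmorphM rmorph_sum rmorph_prod rmorph_sign; congr (_ * _ * _).
  by apply: eq_bigr => l _; rewrite rmorphM !rmorphXn.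
by apply: eq_bigr => a _; rewrite rmorphM rmorph_int.
Qed.

Lemma rmorph_rhs : f (rhs_ring x y z) = rhs_ring (f \o x) (f \o y) (f \o z).
Proof.
rewrite rmorph_sum; apply: eq_bigr => sigma _.
rewrite rmorph_sum; apply: eq_bigr => r _; rewrite rmorph_sum; apply: eq_bigr => k _.
rewrite rmorphM rmorph_sum rmorph_prod; congr (_ * _).
by apply: eq_bigr => l _; rewrite rmorphM !rmorphXn !rmorph_Pform.
Qed.

End Sides.

Lemma eq_lhs_ring s t n m (R : comNzRingType) (x x' y y' : 'I_(s + t) -> R) z z' :
  x =1 x' -> y =1 y' -> z =1 z' -> lhs_ring n m x y z = lhs_ring n m x' y' z'.
Proof. by move=> /funext-> /funext-> /funext->. Qed.

Lemma eq_rhs_ring s t n m (R : comNzRingType) (x x' y y' : 'I_(s + t) -> R) z z' :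
  x =1 x' -> y =1 y' -> z =1 z' -> rhs_ring n m x y z = rhs_ring n m x' y' z'.
Proof. by move=> /funext-> /funext-> /funext->. Qed.

Lemma weight_flatten (aa : seq (seq nzint)) :
  weight (flatten aa) = (\sum_(a <- aa) weight a)%N.
Proof. by rewrite /weight big_flatten. Qed.

Lemma sgn_flatten (aa : seq (seq nzint)) : sgn (flatten aa) = \prod_(a <- aa) sgn a.
Proof. by rewrite /sgn big_flatten. Qed.

(** * The identity at one odd prime *)

Section OnePrime.
Variables (R : comNzRingType) (p : nat) (u : nat -> R).
Hypotheses (p_odd : odd p) (pR0 : p%:R = 0 :> R).
Hypothesis uK : forall N, (0 < N < p)%N -> u N * N%:R = 1.
Variable z : seq nzint -> R.
Hypothesis zE : forall a, z a = \sum_(N < p) run (rev (map (term u) a)) (delta0 R) N.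
Variables (s t n m : nat) (x y : 'I_(s + t) -> R).

Let vx := [seq (x (lshift t i), y (lshift t i)) | i <- rev (enum 'I_s)].
Let wx := [seq (x (rshift s j), y (rshift s j)) | j <- rev (enum 'I_t)].

Lemma lhs_ring_fam : lhs_ring n m x y z =
  fam n m x y (fun a => \sum_(N < p) \sum_(M < N.+1)
    run (map (term u) (flatten [seq rev (a (lshift t l)) | l <- rev (enum 'I_s)])) (delta0 R) M *
    run (map (term u) (flatten [seq a (rshift s l) | l <- rev (enum 'I_t)])) (delta0 R) (N - M)%N).
Proof.
apply: eq_bigr => r _; apply: eq_bigr => k _.
rewrite -mulrA mulrCA; congr (_ * _); rewrite mulr_sumr.
apply: eq_big_seq => a; rewrite in_fset_set ?inE; last exact: finite_Sprod.
move=> Sa; rewrite zE /concat_rev map_cat sum_run_cat !mulr_sumr; apply: eq_bigr => N _.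
rewrite !mulr_sumr; apply: eq_bigr => M _.
rewrite -(map_rev (term u)) rev_flatten.
have -> : rev [seq rev i | i <- [seq a (lshift t l) | l <- enum 'I_s]] =
          [seq rev (a (lshift t l)) | l <- rev (enum 'I_s)].
  by rewrite -(map_comp rev) -(map_rev (rev \o _)).
rewrite -(map_rev (fun v => a (rshift s v))).
set A2 := flatten [seq a (rshift s v) | v <- _].
(* A block in [Ssgn r k] has weight r + k + 1, and the extra 1 of each of the t blocks adds up to
   the summand t. *)
have -> : q_exp r k = weight A2.
  rewrite weight_flatten big_map big_rev big_enum /= /q_exp.
  rewrite -[X in (_ + X)%N]card_ord -sum1_card -big_split; apply: eq_bigr => v _ /=.
  by have [_ ->] := Sa (rshift s v).
have -> : \prod_(v < t) sgn (a (rshift s v)) = sgn A2.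
  by rewrite sgn_flatten big_map big_rev big_enum.
rewrite mulrA mulrCA; congr (_ * _); rewrite run_refl //.
by have := ltn_ord N; lia.
Qed.

Lemma lhs_ring_conv : lhs_ring n m x y z =
  \sum_(N < p) conv3 (gencoef u vx) (gencoef u wx) n m N.
Proof.
rewrite lhs_ring_fam fam_split [RHS]exchange_big; apply: eq_bigr => i _ /=.
rewrite [RHS]exchange_big; apply: eq_bigr => j _ /=.
have Hw L : fam (n - i) (m - j) (x \o @rshift s t) (y \o @rshift s t) (fun a2 =>
    run (map (term u) (flatten [seq a2 l | l <- rev (enum 'I_t)])) (delta0 R) L) =
    gencoef u wx (n - i) (m - j) L.
  by apply: (fam_H u _ _ _ _ _ (g := id)) => w k; rewrite map_id.
under eq_fam => a1.
  under eq_fam => a2.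
    under eq_bigr => N _.
      under eq_bigr => M _.
        under [X in flatten X]eq_map => l do rewrite glue_l.
        under [X in _ * run (map _ (flatten X)) _ _]eq_map => l do rewrite glue_r.
        over.
      over.
    over.
  rewrite fam_sum.
  under eq_bigr => N _.
    rewrite fam_sum.
    under eq_bigr => M _ do rewrite famZ Hw.
    over.
  over.
rewrite fam_sum; apply: eq_bigr => N _; rewrite fam_sum; apply: eq_bigr => M _.
under eq_fam do rewrite mulrC.
rewrite famZ mulrC; congr (_ * _).
(* The unreflected blocks are read backwards, hence the choice of [rev]. *)
by apply: fam_H => w k; apply: perm_indices_rev.
Qed.

Lemma rhs_ring_H : rhs_ring n m x y z =
  \sum_(N < p) \sum_(sigma in Wset s t)
    gencoef u [seq (Pform sigma x l, Pform sigma y l) | l <- rev (enum 'I_(s + t))] n m N.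
Proof.
rewrite exchange_big; apply: eq_bigr => sigma _ /=.
under eq_fam do rewrite zE; rewrite fam_sum; apply: eq_bigr => N _.
rewrite -(fam_H _ _ _ _ _ _ (g := rev)); last by move=> w k; apply: perm_indices_rev.
apply: eq_fam => a; rewrite -map_rev /concat rev_flatten.
by congr (run (map _ (flatten _)) _ _); rewrite -(map_rev rev) -(map_rev a) -(map_comp rev).
Qed.

Theorem sides_eq : lhs_ring n m x y z = rhs_ring n m x y z.
Proof.
rewrite lhs_ring_conv rhs_ring_H; apply: eq_bigr => N _.
rewrite -(sum_H_shuf uK (k := s + t)) ?size_map ?size_rev ?size_enum_ord //.
rewrite -(sum_Wset (fun l => (x l, y l)) (fun l => gencoef u l n m N)).
apply: eq_bigr => sigma _; congr (gencoef _ _ _ _ _); apply: eq_map => l.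
exact: Pform_pair.
Qed.

End OnePrime.

(** * From the prime fields to the quotient ring *)

Definition evalp (p : primeT) (f : prodFp) : 'F_(val p) := f p.

Fact evalp_is_additive p : zmod_morphism (evalp p). Proof. by []. Qed.
Fact evalp_is_multiplicative p : monoid_morphism (evalp p). Proof. by []. Qed.

HB.instance Definition _ p :=
  GRing.isZmodMorphism.Build prodFp 'F_(val p) (evalp p) (evalp_is_additive p).
HB.instance Definition _ p :=
  GRing.isMonoidMorphism.Build prodFp 'F_(val p) (evalp p) (evalp_is_multiplicative p).

Lemma odd_prime_sides_eq (p : primeT) s t n m (x y : 'I_(s + t) -> {mpoly 'F_(val p)[(s + t) + (s + t)]}) :
  odd (val p) ->
  lhs_ring n m x y (fun a => (zeta_p a p)%:MP) = rhs_ring n m x y (fun a => (zeta_p a p)%:MP).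
Proof.
move=> p_odd; have p_pr := valP p; have cp := pchar_Fp p_pr.
(* Inverses mod p are taken in the prime field and embedded as constant polynomials. *)
apply: (@sides_eq _ (val p) (fun N => (N%:R^-1)%:MP)) => //.
- by rewrite -(rmorph_nat (@mpolyC _ _)) (pcharf0 cp) rmorph0.
- move=> N /andP[N_gt0 ltNp]; rewrite -(rmorph_nat (@mpolyC _ _)) -rmorphM mulVf //.
  by rewrite -(dvdn_pcharf cp) gtnNdvd.
move=> a; rewrite zeta_p_nested rmorph_sum; apply: eq_bigr => N _ /=.
rewrite -!map_rev; elim: (rev a) (nat_of_ord N) => [|b l IHl] k /=.
  by rewrite /delta0 rmorph_nat.
rewrite rmorphM; congr (_ * _).
  by rewrite /term rmorphM !rmorphXn rmorph_int.
by rewrite rmorph_sum; apply: eq_bigr => M _; apply: IHl.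
Qed.

(** The difference is supported on the single prime 2, hence lies in the ideal. *)
Lemma pi_calA_eq (f g : prodFp) : (forall p : primeT, odd (val p) -> f p = g p) ->
  (\pi_calA f = \pi_calA g)%qT.
Proof.
move=> fg; apply/eqP; rewrite -Quotient.idealrBE; apply/asboolP.
apply: (@sub_finite_set _ _ [set exist prime 2%N isT]%classic); last exact: finite_set1.
move=> p /=; have -> : (f - g) p = f p - g p by [].
have [/fg->|/negbTE p2 _] := boolP (odd (val p)); first by rewrite subrr eqxx.
apply: val_inj => /=; apply/eqP; have := even_prime (valP p).
by case=> [->|] //; rewrite p2.
Qed.

Definition piA : {rmorphism prodFp -> calA} := \pi_calA%qT.

Lemma eq_map_mpolyP (A B : nzRingType) (f : {rmorphism A -> B}) N (P Q : {mpoly A[N]}) :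
  map_mpoly f P = map_mpoly f Q <-> forall e, f P@_e = f Q@_e.
Proof.
split=> [fPQ e|fPQ]; first by rewrite -!mcoeff_map_mpoly fPQ.
by apply/mpolyP => e; rewrite !mcoeff_map_mpoly; apply: fPQ.
Qed.

Lemma map_piA_eq N (P Q : {mpoly prodFp[N]}) :
  (forall p : primeT, odd (val p) -> map_mpoly (evalp p) P = map_mpoly (evalp p) Q) ->
  map_mpoly piA P = map_mpoly piA Q.
Proof.
move=> PQ; apply/eq_map_mpolyP => e; apply: pi_calA_eq => p /PQ.
by move/eq_map_mpolyP/(_ e).
Qed.

Theorem theorem3p1 (n m s t : nat)
    (n_gt0 : (0 < n)%N) (m_gt0 : (0 < m)%N)
    (s_gt0 : (0 < s)%N) (t_gt0 : (0 < t)%N) :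
  \sum_(r <- fset_set (Zset (s + t) n)) \sum_(k <- fset_set (Zset (s + t) m))
     (-1) ^+ q_exp r k
     * (\prod_(l < s + t) (lam l ^+ r l * mu l ^+ k l))
     * (\sum_(a <- fset_set (Sprod r k))
          (\prod_(u < t) sgn (a (rshift s u)))%:~R * zetaA (concat_rev a))%:MP
  =
  \sum_(sigma in Wset s t)
    \sum_(r <- fset_set (Zset (s + t) n)) \sum_(k <- fset_set (Zset (s + t) m))
     (\prod_(l < s + t)
        (Pform sigma (@lam s t) l ^+ r l * Pform sigma (@mu s t) l ^+ k l))
     * (\sum_(a <- fset_set (Sprod r k)) zetaA (concat a))%:MP
  :> {mpoly calA[(s + t) + (s + t)]}.
Proof.
pose N := ((s + t) + (s + t))%N.
transitivity (lhs_ring n m (@lam s t) (@mu s t) (fun a => (zetaA a)%:MP)).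
  apply: eq_bigr => r _; apply: eq_bigr => k _; congr (_ * _).
  by rewrite rmorph_sum; apply: eq_bigr => a _; rewrite rmorphM rmorph_int.
transitivity (rhs_ring n m (@lam s t) (@mu s t) (fun a => (zetaA a)%:MP)); last first.
  apply: eq_bigr => sigma _; apply: eq_bigr => r _; apply: eq_bigr => k _.
  by rewrite rmorph_sum.
(* Both sides are lifted to polynomials over the full product of the prime fields, where evaluation
   at each prime is a ring morphism. *)
pose x l : {mpoly prodFp[N]} := 'X_(lshift (s + t) l).
pose y l : {mpoly prodFp[N]} := 'X_(rshift (s + t) l).
pose z a : {mpoly prodFp[N]} := (zeta_p a : prodFp)%:MP.
pose F := map_mpoly piA : {mpoly prodFp[N]} -> {mpoly calA[N]}.
have Fx l : F (x l) = lam l by rewrite /F map_mpolyX.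
have Fy l : F (y l) = mu l by rewrite /F map_mpolyX.
have Fz a : F (z a) = (zetaA a)%:MP by rewrite /F map_mpolyC.
rewrite -(eq_lhs_ring _ _ Fx Fy Fz) -(eq_rhs_ring _ _ Fx Fy Fz).
rewrite -(rmorph_lhs _ _ (map_mpoly piA)) -(rmorph_rhs _ _ (map_mpoly piA)).
apply: map_piA_eq => p p_odd; rewrite rmorph_lhs rmorph_rhs.
pose G := map_mpoly (evalp p) : {mpoly prodFp[N]} -> {mpoly 'F_(val p)[N]}.
have Gz a : G (z a) = (zeta_p a p)%:MP by rewrite /G map_mpolyC.
rewrite (eq_lhs_ring _ _ (frefl _) (frefl _) Gz) (eq_rhs_ring _ _ (frefl _) (frefl _) Gz).
exact: odd_prime_sides_eq.
Qed.
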